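(* Let $\mathfrak C$ be a hereditary class of finite relational structures with a fixed finite signature. Then $\mathfrak C$ is a finite union of ages of relational structures that have a finite monomorphic decomposition if and only if there is an integer $\ell$ such that every member of $\mathfrak C$ has a monomorphic decomposition into at most $\ell$ blocks.
   Context: A relational structure of signature $\mu=(n_i)_{i\in I}$ is a pair $\mathcal R=(V,(\rho_i)_{i\in I})$ where $V$ is a set (the domain) and each $\rho_i\subseteq V^{n_i}$ is an $n_i$-ary relation on $V$; the signature is finite if $I$ is finite. $\mathcal R_{\restriction A}$ denotes the substructure induced on $A\subseteq V$. $\mathcal R$ embeds into $\mathcal R'$ if $\mathcal R$ is isomorphic to an induced substructure of $\mathcal R'$. Finite structures are considered up to isomorphism. A class $\mathfrak C$ of structures of signature $\mu$ is hereditary if every structure embeddable into a member of $\mathfrak C$ belongs to $\mathfrak C$. The age of $\mathcal R$ is the set $\mathrm{Age}(\mathcal R)$ of the induced substructures of $\mathcal R$ on finite subsets of its domain, considered up to isomorphism. A monomorphic decomposition of $\mathcal R$ is a partition $(V_j)_{j\in J}$ of its domain $V$ such that for all finite subsets $A,A'$ of $V$, the induced structures $\mathcal R_{\restriction A}$ and $\mathcal R_{\restriction A'}$ are isomorphic whenever $|A\cap V_j|=|A'\cap V_j|$ for every $j\in J$. It is finite if it has finitely many blocks. *)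

(* Defs.v *)
From mathcomp Require Import all_boot.
From mathcomp Require Import boolp classical_sets functions cardinality.

Set Implicit Arguments.
Unset Strict Implicit.
Unset Printing Implicit Defensive.

Local Open Scope classical_set_scope.
Local Open Scope card_scope.

(* Classes of structures are plain predicates [structure mu -> Prop]: the type
   [set (structure mu)] would force the universe of the domains strictly below
   that of [set].  For similar universe reasons [induced] spells out the
   coercion [set_type].
   Domains may be empty and relations may be nullary. *)
Record structure (I : Type) (mu : I -> nat) := Structure {
  dom :> Type;
  rel_of : forall i : I, set ((mu i).-tuple dom)
}.

Section Structures.
Variables (I : Type) (mu : I -> nat).
Implicit Types (R S : structure mu) (C : structure mu -> Prop).

Definition isomorphic R S : Prop :=
  exists2 f : R -> S, bijective f &
    forall (i : I) (t : (mu i).-tuple R),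
      rel_of t <-> rel_of (map_tuple f t).

Definition induced R (A : set R) : structure mu :=
  @Structure I mu {x : R | x \in A}
    (fun i => [set t | rel_of (map_tuple val t)]).

Definition embeds R S : Prop :=
  exists A : set S, isomorphic R (induced A).

Definition finite_structure R : Prop := finite_set [set: R].

Definition hereditary C : Prop :=
  forall R S, C S -> embeds R S -> C R.

(* Identification up to isomorphism is rendered by closing under it. *)
Definition age R (S : structure mu) : Prop :=
  exists2 A : set R, finite_set A & isomorphic S (induced A).

(* [partition] requires nonempty blocks. *)
Definition monomorphic_decomposition R (J : Type) (V : J -> set R) : Prop :=
  partition [set: J] V [set: R] /\
  forall A A' : set R, finite_set A -> finite_set A' ->
    (forall j : J, (A `&` V j) #= (A' `&` V j)) ->
    isomorphic (induced A) (induced A').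

Definition has_finite_monomorphic_decomposition R : Prop :=
  exists (J : finType) (V : J -> set R), monomorphic_decomposition V.

Definition has_monomorphic_decomposition_le (l : nat) R : Prop :=
  exists (J : finType) (V : J -> set R),
    monomorphic_decomposition V /\ #|J| <= l.

End Structures.

(* Main.v *)
(* Call a finite structure p-chainable if its domain can be coloured with p
   colours and linearly ordered inside each colour so that the relations of a tuple
   depend only on the colours of its entries and on their order inside each colour.
   The point is that the finite structures with a monomorphic decomposition into at
   most l blocks are p-chainable for a common p.

   If all one-point-deleted substructures R - y are p-chainable, then R is
   p'-chainable with p' depending only on p and the arity: up to boundedly many
   elements, a colour class of a chain consists of interchangeable elements or has
   an order definable with boundedly many parameters, so the chains of R - y, for y
   in a set of 2m+1 points none of which is a parameter for another, have a common
   bounded refinement. By Dickson's lemma p'-chainable structures are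
   well-quasi-ordered, so the minimal non-p-chainable structures have bounded size.
   By Ramsey's theorem large blocks contain homogeneous parts, and monomorphy moves
   any bounded subset into them: bounded subsets are p-chainable, hence R is.

   A p-chainable structure is determined by one of finitely many patterns and the
   vector of sizes of its colours. For each pattern the vectors whose structure lies
   in the class form a downset of N^p, hence a finite union of boxes with possibly
   infinite sides, and each box yields an age. *)
Require Import Defs.
From mathcomp Require Import all_boot.
From mathcomp Require Import boolp perm zify.

Set Implicit Arguments.
Unset Strict Implicit.
Unset Printing Implicit Defensive.

(** * Chains *)

Lemma leq_count_in (T : eqType) (a b : pred T) (s : seq T) :
  {in s, forall x, a x -> b x} -> count a s <= count b s.
Proof.
elim: s => //= x s IH h; apply: leq_add; last first.
  by apply: IH => y ys; apply: h; rewrite inE ys orbT.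
by have := h x (mem_head _ _); case: (a x) => // ->.
Qed.

Lemma ltn_count_in (T : eqType) (a b : pred T) (s : seq T) x :
  {in s, forall x, a x -> b x} -> x \in s -> ~~ a x -> b x ->
  count a s < count b s.
Proof.
move=> h xs ax bx; case/splitPr: xs h => s1 s2 h.
rewrite !count_cat /= (negPf ax) bx add0n addnCA add1n ltnS.
by apply: leq_add; apply: leq_count_in => y ys; apply: h;
   rewrite mem_cat inE ys ?orbT.
Qed.

(** Ranks are compared only inside a colour. Equality of entries is left out: when ranks are
    injective on each colour, it follows from the failure of both strict comparisons. *)
Definition sim (Col T T' : eqType) (c : T -> Col) (r : T -> nat)
    (c' : T' -> Col) (r' : T' -> nat) (z : seq (T * T')) : Prop :=
  {in z &, forall u v, c u.1 = c' u.2 /\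
    (c u.1 = c v.1 -> (r u.1 < r v.1) = (r' u.2 < r' v.2))}.

Section Chains.
Variables (K : finType) (m : nat).

Section Fixed.
Variables (T : finType) (tp : seq T -> K).
Implicit Types (D X : {set T}).

(* A structure on [T] is encoded by the map [tp] sending a sequence to the set of
   relations it satisfies; only sequences of length at most [m], the maximal
   arity, matter. The unzipped components of [z] are two tuples with the same
   colours and the same order inside each colour. *)
Definition chain D (Col : eqType) (c : T -> Col) (r : T -> nat) : Prop :=
  {in D &, forall x y, c x = c y -> r x = r y -> x = y} /\
  forall z : seq (T * T), size z <= m ->
    {in z, forall u, u.1 \in D /\ u.2 \in D} -> sim c r c r z ->
    tp (unzip1 z) = tp (unzip2 z).

(* [p.+1] colours, so that the type of colours is inhabited. *)
Definition chainable D (p : nat) : Prop :=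
  exists (c : T -> 'I_p.+1) (r : T -> nat), chain D c r.

(** Lets each construction take its colours in whichever finite type suits it. *)
Lemma chain_chainable D (Col : finType) (c : T -> Col) r p :
  #|Col| <= p.+1 -> chain D c r -> chainable D p.
Proof.
move=> lep [inj hom].
have cE x y : (inord (enum_rank (c x)) : 'I_p.+1) = inord (enum_rank (c y)) ->
    c x = c y.
  move=> /(congr1 (@nat_of_ord _)); rewrite !inordK ?(leq_trans (ltn_ord _)) //.
  by move=> e; apply/enum_rank_inj/val_inj.
exists (fun x => inord (enum_rank (c x))), r; split.
  by move=> x y xD yD /cE; apply: inj.
move=> z sz zD simz; apply: hom => // u v uz vz.
have [e1 e2] := simz u v uz vz; split; first exact: cE.
by move=> e; apply: e2; rewrite e.
Qed.

(** With one colour per element similar tuples are equal, so the constant ranking is harmless. *)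
Lemma small_chainable D p : #|D| <= p.+1 -> chainable D p.
Proof.
move=> leD; exists (fun x => inord (index x (enum D))), (fun=> 0).
have cE : {in D &, forall x y,
    (inord (index x (enum D)) : 'I_p.+1) = inord (index y (enum D)) -> x = y}.
  have lt x : x \in D -> index x (enum D) < p.+1.
    by move=> xD; rewrite (leq_trans _ leD)// cardE index_mem mem_enum.
  move=> x y xD yD /(congr1 (@nat_of_ord _)); rewrite !inordK ?lt// => e.
  have := nth_index x (s := enum D) (x := y); rewrite -e mem_enum => <-//.
  by rewrite nth_index// mem_enum.
split=> [x y xD yD /cE->//|z _ zD simz].
congr tp; rewrite /unzip1 /unzip2; apply/eq_in_map => u uz.
by apply: cE; [case: (zD u)|case: (zD u)|case: (simz u u)].
Qed.

Lemma chainableW D p p' : p <= p' -> chainable D p -> chainable D p'.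
Proof.
by move=> le [c [r h]]; apply: (chain_chainable _ h); rewrite card_ord.
Qed.

(** Tuples containing both [x] and [y] count too: for [x] and [y] in [D], the transposition is an
    automorphism of the substructure on [D]. *)
Definition interchangeable D (x y : T) : Prop :=
  forall s, size s <= m -> {subset s <= D} -> tp (map (tperm x y) s) = tp s.

Lemma interchangeable_refl D x : interchangeable D x x.
Proof. by move=> s _ _; rewrite tperm1 map_id_in// => a; rewrite perm1. Qed.

Lemma interchangeable_sym D x y : interchangeable D x y -> interchangeable D y x.
Proof. by rewrite /interchangeable tpermC. Qed.

(** For distinct elements, [tperm x w] is the conjugate of [tperm y w] by [tperm x y], hence a
    composite of three automorphisms. *)
Lemma interchangeable_trans D x y w : x \in D -> y \in D -> w \in D ->
  interchangeable D x y -> interchangeable D y w -> interchangeable D x w.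
Proof.
move=> xD yD wD; have [->//|xy] := eqVneq x y; have [->//|yw] := eqVneq y w.
have [->|xw] := eqVneq x w; first by move=> *; apply: interchangeable_refl.
move=> Exy Eyw s sm sD.
have -> : map (tperm x w) s =
    map (tperm x y) (map (tperm y w) (map (tperm x y) s)).
  rewrite -!map_comp; apply: eq_map => a /=.
  case: (tpermP x y a) => [->|->|/eqP ax /eqP ay].
  - by rewrite !(tpermL, tpermR) (@tpermD _ x y w).
  - by rewrite (@tpermD _ y w x) 1?eq_sym// tpermL (@tpermD _ x w y)// eq_sym.
  case: (tpermP x w a) => [/eqP|->|/eqP _ /eqP aw]; first by rewrite (negPf ax).
    by rewrite !tpermR.
  by rewrite (@tpermD _ y w a) 1?eq_sym// tpermD// eq_sym.
have stab a b s0 : a \in D -> b \in D -> {subset s0 <= D} ->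
    {subset map (tperm a b) s0 <= D}.
  by move=> aD bD s0D _ /mapP[d /s0D dD ->]; case: tpermP.
rewrite Exy ?size_map//; last by do 2![apply: (stab)=> //].
rewrite Eyw ?size_map//; last by apply: stab.
exact: Exy.
Qed.

(* If [u.1 <> u.2], transposing them in the first tuple settles this entry
   without disturbing the settled ones. *)
Lemma interchangeable_moves D (z : seq (T * T)) : size z <= m ->
  {in z, forall u, [/\ u.1 \in D, u.2 \in D & interchangeable D u.1 u.2]} ->
  {in z &, forall u v, (u.1 == v.1) = (u.2 == v.2)} ->
  tp (unzip1 z) = tp (unzip2 z).
Proof.
have [n] := ubnP (count (fun u => u.1 != u.2) z).
elim: n z => // n IHn z; rewrite ltnS => le_n sz zD zeq.
have [/hasP[u uz neu]|/hasPn noz] := boolP (has (fun u => u.1 != u.2) z); last first.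
  by congr tp; apply/eq_in_map => u /noz/negPn/eqP.
have [u1D u2D Eu] := zD u uz.
pose z' := [seq (tperm u.1 u.2 v.1, v.2) | v <- z].
have -> : unzip2 z = unzip2 z' by rewrite /unzip2 -map_comp.
rewrite -(Eu (unzip1 z)) ?size_map//; last by move=> _ /mapP[v /zD[? _ _] ->].
have -> : map (tperm u.1 u.2) (unzip1 z) = unzip1 z'.
  by rewrite /unzip1 -!map_comp.
(* An entry equal to [u.1] becomes settled, one equal to [u.2] was unsettled already and moves to
   [u.1], and the others stay. So the number of unsettled entries drops. *)
have tpv v : v \in z ->
    [\/ tperm u.1 u.2 v.1 = v.2, v.1 = u.2 /\ v.1 != v.2 |
        [/\ v.1 != u.1, v.1 != u.2 & tperm u.1 u.2 v.1 = v.1]].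
  move=> vz; case: tpermP => [e|e|/eqP e1 /eqP e2]; last by constructor 3.
    by constructor 1; apply/eqP; rewrite -(zeq u v)// e.
  constructor 2; split=> //; apply/eqP => e'.
  have : u.2 == v.2 by rewrite -e e'.
  by rewrite -zeq// e (negPf neu).
apply: IHn; rewrite ?size_map//.
- apply: leq_trans le_n; rewrite count_map.
  apply: (ltn_count_in (x := u)) => //=; last by rewrite tpermL eqxx.
  by move=> v vz; case: (tpv v vz) => [->|[-> ]//|[_ _ ->]//]; rewrite eqxx.
- move=> _ /mapP[v vz ->] /=; have [v1D v2D Ev] := zD v vz; split=> //.
    by case: tpermP.
  case: (tpv v vz) => [->|[e _]|[_ _ ->]//]; first exact: interchangeable_refl.
  rewrite e tpermR; apply: (@interchangeable_trans _ _ u.2) => //.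
  by rewrite -e.
- move=> _ _ /mapP[v vz ->] /mapP[w wz ->] /=.
  by rewrite (inj_eq perm_inj) zeq.
Qed.

(** * Ranks in a finite linear order *)

Section Rank.
Variables (X : {set T}) (r : T -> nat).
Hypothesis rinj : {in X &, injective r}.

Definition rank x := #|[set y in X | r y < r x]|.
Definition corank x := #|[set y in X | r x < r y]|.

Lemma ltn_rank x y : x \in X -> (r x < r y) -> rank x < rank y.
Proof.
move=> xX xy; apply: proper_card; apply/properP; split.
  by apply/subsetP => w; rewrite !inE => /andP[-> /ltn_trans->].
by exists x; rewrite !inE ?xX// ltnn.
Qed.

Lemma rankE x y : x \in X -> y \in X -> (rank x < rank y) = (r x < r y).
Proof.
move=> xX yX; have [/ltn_rank->//|yx|/rinj->//] := ltngtP (r x) (r y).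
  by apply/negbTE; rewrite -leqNgt ltnW// ltn_rank.
by rewrite ltnn.
Qed.

Lemma rank_inj : {in X &, injective rank}.
Proof.
move=> x y xX yX e; apply: rinj => //.
by case: (ltngtP (r x) (r y)); rewrite // -rankE// e ltnn.
Qed.

Lemma rank_lt x : x \in X -> rank x < #|X|.
Proof.
move=> xX; apply: proper_card; apply/properP; split.
  by apply/subsetP => w; rewrite inE => /andP[].
by exists x; rewrite // inE ltnn andbF.
Qed.

Lemma rank_corank x : x \in X -> rank x + corank x = #|X|.-1.
Proof.
move=> xX; rewrite (cardsD1 x) xX /= /rank /corank -cardsUI.
have -> : [set y in X | r y < r x] :&: [set y in X | r x < r y] = set0.
  by apply/setP => y; rewrite !inE; case: ltngtP; rewrite ?andbF.
rewrite cards0 addn0; apply: eq_card => y.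
rewrite !inE -andb_orr andbC -neq_ltn.
have [yX|] := boolP (y \in X); rewrite ?andbF ?andbT//.
by congr (~~ _); apply/eqP/eqP => [/rinj->|->].
Qed.

(** An injection of [X] into the numbers below [#|X|] is onto by counting. Writing [#|X|] as a
    successor serves [inord]. *)
Lemma rank_onto j : j < #|X| -> exists2 x, x \in X & rank x = j.
Proof.
move=> jX.
pose f x : 'I_#|X|.-1.+1 := inord (rank x).
have X0 : #|X|.-1.+1 = #|X| by rewrite prednK// (leq_ltn_trans _ jX).
have finj : {in X &, injective f}.
  move=> x y xX yX /(congr1 (@nat_of_ord _)); rewrite /= !inordK ?X0 ?rank_lt//.
  exact: rank_inj.
have fX : f @: X = setT.
  by apply/eqP; rewrite eqEcard subsetT card_in_imset// cardsT card_ord X0 leqnn.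
have : inord j \in f @: X by rewrite fX inE.
case/imsetP => x xX /(congr1 (@nat_of_ord _)); rewrite /= !inordK ?X0 ?rank_lt//.
by exists x.
Qed.

End Rank.

Lemma card_inj_lt (A : {set T}) (f : T -> nat) n :
  {in A &, injective f} -> {in A, forall x, f x < n} -> #|A| <= n.
Proof.
move=> finj flt; rewrite cardE -(size_map f) -[n](size_iota 0).
apply: uniq_leq_size.
  by rewrite map_inj_in_uniq ?enum_uniq// => x y; rewrite !mem_enum; apply: finj.
by move=> y /mapP[x]; rewrite mem_enum => xA ->; rewrite mem_iota /= flt.
Qed.

(** The template [s] plays the part of an atomic formula in two variables: [inl] carries a
    parameter, [inr true] and [inr false] are the two variables. *)
Definition fill (s : seq (T + bool)) (x y : T) : seq T :=
  [seq match a with inl t => t | inr b => if b then x else y end | a <- s].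

End Fixed.
End Chains.

(** * Interchangeability or definable order in a colour class *)

Section Dichotomy.
Variables (K : finType) (m : nat) (T : finType) (tp : seq T -> K).
Implicit Types (D : {set T}).

(* Consecutive elements of a class that are not interchangeable are told apart by
   a tuple. Its other members in the class can be pushed among the [m] lowest and
   the [m] highest elements, which are put into [G]; the same parameters then
   define the order of the whole middle part of the class. *)
Lemma class_dichotomy D (Col : eqType) (c : T -> Col) r (k : Col) :
  chain m tp D c r -> exists G : {set T}, [/\ G \subset D, #|G| <= 3 * m &
    {in D :\: G &, forall x y, c x = k -> c y = k -> interchangeable m tp D x y} \/
    exists s t, [/\ size s <= m, forall a, inl a \in s -> a \in G &
      {in D :\: G &, forall x y, c x = k -> c y = k -> x != y ->
         (tp (fill s x y) == t) = (r x < r y)}]].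
Proof.
move=> [inj hom]; pose X := [set x in D | c x == k].
have XD : X \subset D by apply/subsetP => x; rewrite inE => /andP[].
have rinj : {in X &, injective r}.
  move=> x y; rewrite !inE => /andP[xD /eqP cx] /andP[yD /eqP cy].
  by apply: inj => //; rewrite cx.
have rcX := rank_corank rinj.
pose L := [set x in X | (rank X r x < m) || (corank X r x < m)].
have LX : L \subset X by apply/subsetP => x; rewrite inE => /andP[].
have inXL v : (v \in X :\: L) =
    [&& v \in X, m <= rank X r v & m <= corank X r v].
  rewrite in_setD [v \in L]inE; case: (v \in X); rewrite ?andbF//= andbT.
  by rewrite negb_or -!leqNgt.
have cardL : #|L| <= 2 * m.
  have -> : L = [set x in X | rank X r x < m] :|: [set x in X | corank X r x < m].
    by apply/setP => x; rewrite !inE andb_orr.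
  rewrite (leq_trans (leq_card_setU _ _))// mulSn mul1n leq_add//.
    apply: (card_inj_lt (f := rank X r)) => [x y|x]; rewrite !inE; last by case/andP.
    by move=> /andP[xX _] /andP[yX _]; apply: rank_inj; rewrite ?inE.
  apply: (card_inj_lt (f := corank X r)) => [x y|x]; rewrite !inE; last by case/andP.
  move=> /andP[xX _] /andP[yX _] e; apply: (rank_inj rinj); rewrite ?inE//.
  by apply/eqP; rewrite -(eqn_add2r (corank X r x)) {2}e !rcX// inE.
pose bad x y := [/\ x \in X :\: L, y \in X :\: L, r x < r y &
                    ~ interchangeable m tp D x y].
have [[x0 [y0 bad0]]|nobad] := pselect (exists x y, bad x y); last first.
  exists L; split; [exact: subset_trans XD|by rewrite (leq_trans cardL) ?leq_mul|].
  have inX v : v \in D :\: L -> c v = k -> v \in X :\: L.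
    by rewrite !in_setD => /andP[-> vD] /eqP cv; rewrite inE vD cv.
  left=> x y xDL yDL cx cy.
  have [xD yD] : x \in D /\ y \in D.
    by move: xDL yDL; rewrite !in_setD => /andP[_ ->] /andP[_ ->].
  apply: contrapT => nxy; apply: nobad.
  have [xy|yx|e] := ltngtP (r x) (r y).
  - by exists x, y; split; rewrite // inX.
  - exists y, x; split; rewrite // ?inX//.
    by move=> /interchangeable_sym.
  - case: nxy; rewrite (inj x y)// ?cx//; exact: interchangeable_refl.
(* Take a bad pair with the smallest gap [r y - r x]. An element of the class strictly between would
   also avoid [L], and by transitivity would form with [x] or [y] a bad pair of smaller gap. *)
have [x [y [[xXL yXL xy nxy] noin]]] : exists x y, bad x y /\
    {in X, forall u, ~~ (r x < r u < r y)}.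
  pose P n := `[< exists x y, bad x y /\ r y - r x = n >].
  have exP : exists n, P n by exists (r y0 - r x0); apply/asboolP; exists x0, y0.
  case: (ex_minnP exP) => n /asboolP[x [y [[xX yX xy nxy] en]] minn].
  exists x, y; split=> // u uX; apply/negP => /andP[xu uy].
  have uXL : u \in X :\: L.
    move: xX yX; rewrite !inXL => /and3P[xX ? ?] /and3P[yX ? ?].
    rewrite uX /=; move: xu uy; rewrite -!(rankE rinj)//.
    have := rcX _ xX; have := rcX _ yX; have := rcX _ uX; lia.
  have nbad v w : bad v w -> n <= r w - r v.
    by move=> b; apply: minn; apply/asboolP; exists v, w.
  apply: nxy; have inD v : v \in X :\: L -> v \in D.
    by rewrite in_setD => /andP[_ /(subsetP XD)].
  apply: (@interchangeable_trans _ _ _ _ _ _ u); rewrite ?inD//; apply: contrapT => h.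
    have /nbad : bad x u by []. by lia.
  have /nbad : bad u y by []. by lia.
have [s [sm sD neq]] : exists s, [/\ size s <= m, {subset s <= D} &
    tp (map (tperm x y) s) <> tp s].
  apply: contrapT => h; apply: nxy => s sm sD; apply: contrapT => ne.
  by apply: h; exists s.
pose S := [set v in X | v \in s].
have Srinj : {in S &, injective r}.
  by move=> u v; rewrite !inE => /andP[uX _] /andP[vX _]; apply: rinj; rewrite inE.
have Sm : #|S| <= m.
  apply: leq_trans sm; rewrite cardE; apply: uniq_leq_size (enum_uniq _) _.
  by move=> u; rewrite mem_enum inE => /andP[].
have /choice[e eP] : forall j, exists t, j < #|X| -> t \in X /\ rank X r t = j.
  move=> j; have [jX|] := ltnP j #|X|; last by exists x.
  by have [t tX tj] := rank_onto rinj jX; exists t.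
(* The entries [x] and [y] become variables. Entries of the class below [x] are pushed to its lowest
   positions and those above [y] to its highest ones, in their original order; the rest are kept. *)
pose f u : T + bool := if u \notin X then inl u else
  if u == x then inr true else if u == y then inr false else
  inl (e (if r u < r x then rank S r u else #|X|.-1 - corank S r u)).
(* At most [2 * m] extreme elements of the class, and at most [m] entries of [s] outside the
   class. *)
exists (L :|: [set u in D | u \in s & u \notin X]); split.
- by rewrite subUset (subset_trans LX XD); apply/subsetP => u; rewrite inE => /andP[].
- rewrite (leq_trans (leq_card_setU _ _))// -[3]/(2 + 1) mulnDl leq_add// mul1n.
  apply: leq_trans sm; rewrite cardE; apply: uniq_leq_size (enum_uniq _) _.
  by move=> u; rewrite mem_enum inE => /and3P[].
right; exists (map f s), (tp s).
have xX : x \in X by move: xXL; rewrite in_setD => /andP[].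
have yX : y \in X by move: yXL; rewrite in_setD => /andP[].
have Sn u : u \in S -> rank S r u < m /\ corank S r u < m.
  move=> uS; move: (rank_corank Srinj uS) (rank_lt r uS) Sm.
  by clear; lia.
have XLP u : u \in X :\: L -> m <= rank X r u /\ m <= corank X r u.
  by rewrite inXL => /and3P[].
have cardX : 2 * m < #|X|.
  by move: (rcX _ xX) (rank_lt r xX) (XLP _ xXL); clear; lia.
have fP u : u \in s -> u \in X ->
    [\/ u = x, u = y, [/\ r u < r x, u != x, u != y & f u = inl (e (rank S r u))] |
      [/\ r y < r u, u != x, u != y & f u = inl (e (#|X|.-1 - corank S r u))]].
  move=> us uX; rewrite /f uX /=.
  have [->|ux] := eqVneq u x; first by constructor 1.
  have [->|uy] := eqVneq u y; first by constructor 2.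
  case: ltnP => ltx; [by constructor 3|constructor 4; split=> //].
  have rux : r u != r x by apply: contraNneq ux => /rinj->.
  have ruy : r u != r y by apply: contraNneq uy => /rinj->.
  by move: (noin u uX) rux ruy ltx; clear; lia.
split; first by rewrite size_map.
  move=> a /mapP[u us]; have [uX|uX] := boolP (u \in X); last first.
    by rewrite /f uX => -[->]; rewrite in_setU; apply/orP; right; rewrite inE us sD.
  have uS : u \in S by rewrite inE uX.
  have [Su1 Su2] := Sn _ uS.
  case: (fP u us uX) => [->|->|[_ _ _ ->]|[_ _ _ ->]].
  - by rewrite /f xX eqxx.
  - rewrite /f yX eqxx; case: eqP => //.
  - move=> [->]; have [|eX eR] := eP (rank S r u); first by clear -cardX Su1; lia.
    by rewrite inE; apply/orP; left; rewrite inE eX eR Su1.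
  move=> [->]; have [|eX eR] := eP (#|X|.-1 - corank S r u); first by clear -cardX; lia.
  rewrite inE; apply/orP; left; rewrite inE eX /=; apply/orP; right.
  by move: (rcX _ eX); rewrite eR; clear -cardX Su2; lia.
(* [tau] is the identity or the transposition of [x] and [y]. Since [z] and [w] avoid [L], the
   pushed entries lie below or above both of them, so the two tuples are similar. Filling in
   increasing order thus gives [tp s], and in decreasing order the different value on the transposed
   tuple. *)
have key (z w : T) (tau : T -> T) : z \in X :\: L -> w \in X :\: L ->
    (tau x = x /\ tau y = y /\ r z < r w) \/ (tau x = y /\ tau y = x /\ r w < r z) ->
    (forall u, u != x -> u != y -> tau u = u) ->
    tp (map tau s) = tp (fill (map f s) z w).
  move=> zXL wXL txy tu.
  have zX : z \in X by move: zXL; rewrite in_setD => /andP[].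
  have wX : w \in X by move: wXL; rewrite in_setD => /andP[].
  pose g u := match f u with inl t => t | inr b => if b then z else w end.
  have -> : fill (map f s) z w = map g s by rewrite /fill -map_comp.
  have gN u : u \notin X -> g u = u by rewrite /g /f => ->.
  have tX u : (tau u \in X) = (u \in X).
    have [->|ux] := eqVneq u x; first by case: txy => [[->]|[->]]; rewrite xX ?yX.
    have [->|uy] := eqVneq u y; first by case: txy => [[_ [->]]|[_ [->]]]; rewrite ?xX ?yX.
    by rewrite tu.
  have tN u : u \notin X -> tau u = u.
    by move=> uX; apply: tu; apply: contraNneq uX => ->.
  have gX u : u \in s -> u \in X -> g u \in X /\
    [\/ tau u = tau x /\ rank X r (g u) = rank X r z,
       tau u = tau y /\ rank X r (g u) = rank X r w,
       [/\ r u < r x, tau u = u & rank X r (g u) = rank S r u] |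
       [/\ r y < r u, tau u = u & rank X r (g u) = #|X|.-1 - corank S r u]].
    move=> us uX; have uS : u \in S by rewrite inE uX.
    have [Su1 Su2] := Sn _ uS.
    case: (fP u us uX) => [->|->|[? ? ? fu]|[? ? ? fu]].
    - by rewrite /g /f xX eqxx; split=> //; constructor 1.
    - rewrite /g /f yX eqxx (negPf (_ : y != x)); last by apply: contraTneq xy => ->; rewrite ltnn.
      by split=> //; constructor 2.
    - rewrite /g fu; have [|eX eR] := eP (rank S r u); first by clear -cardX Su1; lia.
      by split=> //; constructor 3; rewrite tu.
    - rewrite /g fu; have [|eX eR] := eP (#|X|.-1 - corank S r u); first by clear -cardX; lia.
      by split=> //; constructor 4; rewrite tu.
  have inXD u : u \in X -> u \in D /\ c u = k.
    by rewrite inE => /andP[-> /eqP].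
  have -> : map g s = unzip2 [seq (tau u, g u) | u <- s].
    by rewrite /unzip2 -map_comp.
  have -> : map tau s = unzip1 [seq (tau u, g u) | u <- s].
    by rewrite /unzip1 -map_comp.
  apply: hom; first by rewrite size_map.
    move=> _ /mapP[u us ->] /=; have [uX|uX] := boolP (u \in X); last first.
      by rewrite gN// tN//; split; apply: sD.
    have [/inXD[gD _] _] := gX u us uX.
    by split=> //; have [] := inXD (tau u) _; rewrite ?tX.
  move=> _ _ /mapP[u us ->] /mapP[v vs ->] /=.
  have cg a : a \in s -> c (tau a) = c (g a).
    move=> as_; have [aX|aX] := boolP (a \in X); last by rewrite gN// tN.
    have [/inXD[_ ->] _] := gX a as_ aX.
    by have [] := inXD (tau a) _; rewrite ?tX.
  split; first exact: cg.
  have [uX|uX] := boolP (u \in X); last first.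
    have [vX|vX] := boolP (v \in X); last by rewrite !gN// !tN.
    have [_ ->] := inXD (tau v) (etrans (tX v) vX); rewrite tN// => cu.
    by move: uX; rewrite inE cu eqxx sD.
  have [_ ->] := inXD (tau u) (etrans (tX u) uX) => cv.
  have vX : v \in X by rewrite -tX inE -cv eqxx andbT; have [vX|vX] := boolP (v \in X);
    [have [] := inXD (tau v) (etrans (tX v) vX)|rewrite tN ?sD].
  have [guX guP] := gX u us uX; have [gvX gvP] := gX v vs vX.
  have uS : u \in S by rewrite inE uX.
  have vS : v \in S by rewrite inE vX.
  have := Sn _ uS; have := Sn _ vS; have := rankE Srinj uS vS.
  have := rank_corank Srinj uS; have := rank_corank Srinj vS.
  have := XLP _ zXL; have := XLP _ wXL; have := rcX _ zX; have := rcX _ wX.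
  have := rankE rinj zX wX; have := rankE rinj wX zX.
  rewrite -(rankE rinj guX gvX).
  case: txy => -[e1 [e2 lt]]; rewrite e1 e2 in guP gvP.
    case: guP => [[-> ->]|[-> ->]|[lu -> ->]|[lu -> ->]];
    case: gvP => [[-> ->]|[-> ->]|[lv -> ->]|[lv -> ->]];
    move: lt xy; try move: lu; try move: lv; clear; lia.
  case: guP => [[-> ->]|[-> ->]|[lu -> ->]|[lu -> ->]];
  case: gvP => [[-> ->]|[-> ->]|[lv -> ->]|[lv -> ->]];
  move: lt xy; try move: lu; try move: lv; clear; lia.
move=> z w zDG wDG cz cw zw.
have inXL' u : u \in D :\: (L :|: [set u in D | u \in s & u \notin X]) ->
    c u = k -> u \in X :\: L.
  by rewrite !inE => /andP[/norP[-> _] ->] ->; rewrite eqxx.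
have zXL := inXL' z zDG cz; have wXL := inXL' w wDG cw.
have [lt|gt|ezw] := ltngtP (r z) (r w).
- by rewrite -(key z w id)// ?map_id ?eqxx//; left.
- apply/negbTE/eqP; rewrite -(key z w (tperm x y))//.
    by right; rewrite tpermL tpermR.
  by move=> u ux uy; rewrite tpermD// eq_sym.
- move: zXL wXL zw; rewrite !in_setD => /andP[_ zX] /andP[_ wX].
  by rewrite (rinj _ _ zX wX ezw) eqxx.
Qed.

End Dichotomy.

(** * Adding a point to a chain *)

Lemma card_bigcup_leq (I T : finType) (P : pred I) (G : I -> {set T}) g :
  (forall i, #|G i| <= g) -> #|\bigcup_(i | P i) G i| <= #|P| * g.
Proof.
move=> Gg; rewrite -sum_nat_const.
elim/big_rec2: _ => [|i a A _ leA]; first by rewrite cards0.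
by rewrite (leq_trans (leq_card_setU _ _))// leq_add.
Qed.

(* Some vertex of [A] has in-degree at most [g]; keep it, discard its
   neighbours, and iterate. *)
Lemma independent_set (T : finType) (G : T -> {set T}) g n (A : {set T}) :
  (forall y, #|G y| <= g) -> n * (2 * g).+1 <= #|A| ->
  exists B : {set T}, [/\ B \subset A, #|B| = n &
    {in B &, forall x y, x != y -> y \notin G x}].
Proof.
move=> Gg; elim: n A => [|n IHn] A leA.
  by exists set0; rewrite sub0set cards0; split=> // x; rewrite inE.
(* The edges of the digraph are counted from both ends: the in-degrees cannot all exceed [g] while
   the out-degrees are at most [g]. *)
have [y yA ydeg] : exists2 y, y \in A & #|[set x in A | y \in G x]| <= g.
  apply: contrapT => h.
  have lt : \sum_(y in A) g.+1 <= \sum_(y in A) #|[set x in A | y \in G x]|.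
    apply: leq_sum => y yA; rewrite ltnNge; apply/negP => le; apply: h.
    by exists y.
  have : \sum_(y in A) #|[set x in A | y \in G x]| <= \sum_(x in A) g.
    have -> : \sum_(y in A) #|[set x in A | y \in G x]| =
              \sum_(y in A) \sum_(x in A) (y \in G x).
      apply: eq_bigr => y _; rewrite -sum1_card big_mkcond [RHS]big_mkcond.
      by apply: eq_bigr => x _; rewrite inE; case: (x \in A); case: (y \in G x).
    rewrite exchange_big /=; apply: leq_sum => x _; apply: leq_trans (Gg x).
    rewrite -sum1_card big_mkcond [X in _ <= X]big_mkcond; apply: leq_sum => y _.
    by case: (y \in A); case: (y \in G x).
  move=> /(leq_trans lt); rewrite !sum_nat_const leq_mul2l ltnn orbF => /eqP A0.
  by move: leA; rewrite A0.
(* At most [2 * g + 1] vertices are removed: [y], its out-neighbours and its in-neighbours. *)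
pose A' := A :\: (y |: (G y :|: [set x in A | y \in G x])).
have [|B [BA' cB indB]] := IHn A'.
  have := cardsID (y |: (G y :|: [set x in A | y \in G x])) A.
  have : #|A :&: (y |: (G y :|: [set x in A | y \in G x]))| <= (2 * g).+1.
    apply: leq_trans (subset_leq_card (subsetIr _ _)) _.
    rewrite cardsU1; apply: leq_trans (leq_add (leq_b1 _) (leq_card_setU _ _)) _.
    by rewrite add1n ltnS mul2n -addnn leq_add.
  by move: leA; rewrite -/A'; move: #|A'| #|A| #|_ :&: _| => a b c; clear; lia.
have yNB : y \notin B by apply/negP => /(subsetP BA'); rewrite !inE eqxx.
exists (y |: B); split.
- rewrite subUset sub1set yA; apply: subset_trans BA' _; exact: subsetDl.
- by rewrite cardsU1 yNB cB.
- move=> x x' /setU1P[->|xB] /setU1P[->|x'B]; rewrite ?eqxx// => ne.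
  + by have := subsetP BA' _ x'B; rewrite !inE => /andP[/norP[_ /norP[]]].
  + have := subsetP BA' _ xB; rewrite !inE => /andP[/norP[_ /norP[_ +]] xA].
    by rewrite xA.
  + exact: indB.
Qed.

(** * Common refinement of the chains of the one-point-deleted substructures *)

Section Critical.
Variables (K : finType) (m : nat).

Section Refine.
Variables (T : finType) (tp : seq T -> K) (p n0 gm : nat).
Variables (y : 'I_n0.+1 -> T) (c : 'I_n0.+1 -> T -> 'I_p.+1)
  (r : 'I_n0.+1 -> T -> nat) (G : 'I_n0.+1 -> {set T}) (GG : {set T}).
Hypothesis mn0 : 2 * m <= n0.
Hypothesis yinj : injective y.
Hypothesis chainP : forall i, chain m tp [set~ y i] (c i) (r i).
Hypothesis GGm : #|GG| <= gm.
Hypothesis GGG : forall i, G i \subset GG.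
Hypothesis yGG : forall i, y i \in GG.
Hypothesis yG : forall i j, y j \notin G i.
Hypothesis GP : forall i k,
  {in [set~ y i] :\: G i &, forall x x', c i x = k -> c i x' = k ->
     interchangeable m tp [set~ y i] x x'} \/
  exists s t, [/\ size s <= m, forall a, inl a \in s -> a \in G i &
      {in [set~ y i] :\: G i &, forall x x', c i x = k -> c i x' = k -> x != x' ->
         (tp (fill s x x') == t) = (r i x < r i x')}].

Let Col : finType :=
  ('I_gm.+1 + {ffun 'I_n0.+1 -> 'I_p.+1 * {ffun 'I_gm.+1 -> bool * bool}})%type.

(** Elements of [GG] get private colours; any other element records its colour in every chain and
    its cut over [GG]. Past the end of the enumeration [nth] returns [x] itself, which makes both
    comparisons false. *)
Let C (x : T) : Col := if x \in GG then inl (inord (index x (enum GG))) else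
  inr [ffun i => (c i x, [ffun j : 'I_gm.+1 => let t := nth x (enum GG) j in
                   (r i t < r i x, r i x < r i t)])].

Let index_lt t : t \in GG -> index t (enum GG) < gm.+1.
Proof.
by move=> tG; rewrite ltnS (leq_trans _ GGm)// cardE ltnW// index_mem mem_enum.
Qed.

Let C_GG x x' : x \in GG -> C x = C x' -> x' = x.
Proof.
rewrite /C => xG; rewrite xG; case: ifP => // x'G -[] /(congr1 (@nat_of_ord _)).
rewrite !inordK ?index_lt// => e.
have := nth_index x (s := enum GG) (x := x'); rewrite -e mem_enum => <-//.
by rewrite nth_index// mem_enum.
Qed.

Let C_in x x' : C x = C x' -> (x' \in GG) = (x \in GG).
Proof. by rewrite /C; case: ifP; case: ifP. Qed.

Let C_c i x x' : x \notin GG -> C x = C x' -> c i x = c i x'.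
Proof.
move=> xG e; move: (e); rewrite /C (C_in e) (negPf xG) => -[] /ffunP /(_ i).
by rewrite !ffunE => -[].
Qed.

Let C_cut i t x x' : x \notin GG -> t \in GG -> C x = C x' ->
  (r i t < r i x) = (r i t < r i x') /\ (r i x < r i t) = (r i x' < r i t).
Proof.
move=> xG tG e; move: (e); rewrite /C (C_in e) (negPf xG) => -[] /ffunP /(_ i).
rewrite !ffunE => -[_ /ffunP /(_ (inord (index t (enum GG))))].
by rewrite !ffunE inordK ?index_lt// !nth_index ?mem_enum// => -[].
Qed.

(** Provides a chain in which the order of the two elements, if they share a colour there, is forced
    by their refined colours: an element of [GG] separates them. *)
Let C_neq x x' : x \notin GG -> x' \notin GG -> C x <> C x' ->
  exists i, c i x <> c i x' \/ exists2 t, t \in GG &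
    (r i t < r i x) <> (r i t < r i x') \/ (r i x < r i t) <> (r i x' < r i t).
Proof.
move=> xG x'G ne; apply: contrapT => h; apply: ne.
rewrite /C (negPf xG) (negPf x'G); congr inr; apply/ffunP => i; rewrite !ffunE.
congr (_, _); first by apply: contrapT => ne; apply: h; exists i; left.
apply/ffunP => j; rewrite !ffunE.
have [jlt|jge] := ltnP j (size (enum GG)); last by rewrite !nth_default// !ltnn.
rewrite (set_nth_default x)//.
have tG : nth x (enum GG) j \in GG by rewrite -mem_enum mem_nth.
by congr (_, _); apply: contrapT => ne; apply: h; exists i; right;
  exists (nth x (enum GG) j) => //; [left|right].
Qed.

Let notin_y i x : x \notin GG -> x \in [set~ y i] :\: G i.
Proof.
move=> xG; rewrite !inE (contraNN (subsetP (GGG i) x) xG) /=.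
by apply: contraNneq xG => ->.
Qed.

Let notin_y1 i x : x \notin GG -> x \in [set~ y i].
Proof. by move=> xG; have := notin_y i xG; rewrite in_setD => /andP[]. Qed.

Let r_inj i x x' : x \in [set~ y i] -> x' \in [set~ y i] ->
  c i x = c i x' -> r i x = r i x' -> x = x'.
Proof. by have [h _] := chainP i; apply: h. Qed.

(* Two tuples of the same pattern miss some [y i], so they can be compared in the
   chain [c i, r i]. A definable order of that chain is constant on the refined
   pattern because the defining parameters lie in [GG] and miss every [y j], so
   they can be evaluated in any other chain; on the remaining classes the entries
   are moved by interchangeability. *)
Lemma chain_refine : chain m tp setT C (r ord0).
Proof.
split=> [x x' _ _ e|z sz _ simz].
  have [xG|xG] := boolP (x \in GG); first by rewrite (C_GG xG e).
  have x'G : x' \notin GG by rewrite (C_in e).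
  by apply: r_inj; [apply: notin_y1..|apply: C_c].
have Cz u : u \in z -> C u.1 = C u.2 by move=> uz; have [] := simz u u uz uz.
have [i /andP[yi1 yi2]] :
    exists i, (y i \notin unzip1 z) && (y i \notin unzip2 z).
  apply: contrapT => h.
  (* These [n0.+1] distinct points cannot all occur among the at most [2 * m] entries of the two
     tuples. *)
  have : size (map y (enum 'I_n0.+1)) <= size (unzip1 z ++ unzip2 z).
    apply: uniq_leq_size; first by rewrite map_inj_uniq// enum_uniq.
    move=> _ /mapP[j _ ->]; rewrite mem_cat; apply: contrapT => /negP.
    by rewrite negb_or => hj; apply: h; exists j.
  rewrite size_cat !size_map -enumT size_enum_ord; move: mn0 sz; clear; lia.
have zi u : u \in z -> u.1 \in [set~ y i] /\ u.2 \in [set~ y i].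
  move=> uz; rewrite !inE; split.
    by apply: contraNneq yi1 => <-; apply: map_f.
  by apply: contraNneq yi2 => <-; apply: map_f.
have eqz u v : u \in z -> v \in z -> u.1 = v.1 <-> u.2 = v.2.
  move=> uz vz; have [uG|uG] := boolP (u.1 \in GG).
    have e2 := C_GG uG (Cz u uz); rewrite e2; split=> [e|e].
      by rewrite e (C_GG _ (Cz v vz)) -?e.
    have vG : v.1 \in GG by rewrite -(C_in (Cz v vz)) -e.
    by rewrite e; apply: C_GG (Cz v vz).
  have uG2 : u.2 \notin GG by rewrite (C_in (Cz u uz)).
  split=> e.
    have eC : C u.2 = C v.2 by rewrite -!Cz// e.
    have [_ h] := simz u v uz vz; have [_ h'] := simz v u vz uz.
    rewrite e in h h'; have {}h := h erefl; have {}h' := h' erefl.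
    rewrite ltnn in h h'.
    apply: (@r_inj ord0); rewrite ?notin_y1 ?(C_in eC)//; first exact: C_c.
    by move: h h'; case: ltngtP.
  have eC : C u.1 = C v.1 by rewrite !Cz// e.
  have [_ h] := simz u v uz vz; have [_ h'] := simz v u vz uz.
  rewrite e in h h'; have {}h := h eC; have {}h' := h' (esym eC).
  rewrite ltnn in h h'.
  apply: (@r_inj ord0); rewrite ?notin_y1 ?(C_in eC)//; first exact: C_c.
  by move: h h'; case: ltngtP.
(* The passage from [unzip1 z] to [unzip2 z] goes through [[seq f u | u <- z]]: the entries in
   interchangeable classes are moved first, then the result is compared with [unzip2 z] in the chain
   [i], where the moved entries already agree. *)
pose free k := `[< {in [set~ y i] :\: G i &, forall x x', c i x = k ->
  c i x' = k -> interchangeable m tp [set~ y i] x x'} >].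
pose mv (u : T * T) := (u.1 \notin GG) && free (c i u.1).
pose f (u : T * T) := if mv u then u.2 else u.1.
have f2 u : u \in z -> C (f u) = C u.2.
  by move=> uz; rewrite /f; case: ifP => // _; apply: Cz.
have mvE u v : C u.1 = C v.1 -> mv u = mv v.
  rewrite /mv => e; rewrite (C_in e).
  by have [//|uG] := boolP (u.1 \in GG); rewrite (C_c i uG e).
have -> : tp (unzip1 z) = tp [seq f u | u <- z].
  have -> : unzip1 z = unzip1 [seq (u.1, f u) | u <- z] by rewrite /unzip1 -map_comp.
  have -> : [seq f u | u <- z] = unzip2 [seq (u.1, f u) | u <- z].
    by rewrite /unzip2 -map_comp.
  apply: (@interchangeable_moves _ m _ tp [set~ y i]).
  - by rewrite size_map.
  - move=> _ /mapP[u uz ->] /=; have [u1 u2] := zi u uz.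
    split=> //; first by rewrite /f; case: ifP.
    rewrite /f; case: ifP => [/andP[uG /asboolP h]|_]; last exact: interchangeable_refl.
    apply: h => //; rewrite ?notin_y// ?(C_in (Cz u uz))//.
    by rewrite (C_c i uG (Cz u uz)).
  - move=> _ _ /mapP[u uz ->] /mapP[v vz ->] /=; apply/eqP/eqP => e.
      by rewrite /f (@mvE u v) ?e//; case: ifP => // _; apply/(eqz u v uz vz).
    have eC : C u.1 = C v.1 by rewrite (Cz u uz) (Cz v vz) -(f2 u uz) -(f2 v vz) e.
    by move: e; rewrite /f (mvE _ _ eC); case: ifP => // _ e; apply/(eqz u v uz vz).
have -> : [seq f u | u <- z] = unzip1 [seq (f u, u.2) | u <- z].
  by rewrite /unzip1 -map_comp.
have -> : unzip2 z = unzip2 [seq (f u, u.2) | u <- z] by rewrite /unzip2 -map_comp.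
have [_ hom] := chainP i; apply: hom; first by rewrite size_map.
  move=> _ /mapP[u uz ->] /=; have [u1 u2] := zi u uz.
  by split=> //; rewrite /f; case: ifP.
move=> _ _ /mapP[u uz ->] /mapP[v vz ->] /=.
have cf w : w \in z -> c i (f w) = c i w.2.
  move=> wz; rewrite /f; case: ifP => // _.
  have [wG|wG] := boolP (w.1 \in GG); first by rewrite (C_GG wG (Cz w wz)).
  by rewrite (C_c i wG (Cz w wz)).
split=> [|ec]; first exact: cf.
have fG w : w \in z -> w.1 \in GG -> f w = w.1 /\ w.2 = w.1.
  by move=> wz wG; rewrite /f /mv wG /= (C_GG wG (Cz w wz)).
have f2N w : w \in z -> w.1 \notin GG -> f w \notin GG /\ w.2 \notin GG.
  by move=> wz wG; rewrite (C_in (esym (f2 w wz))) (C_in (Cz w wz)).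
have [uG|uG] := boolP (u.1 \in GG).
  have [-> ->] := fG u uz uG.
  have [vG|vG] := boolP (v.1 \in GG); first by have [-> ->] := fG v vz vG.
  have [fvG _] := f2N v vz vG.
  by have [-> _] := C_cut i fvG uG (f2 v vz).
have [vG|vG] := boolP (v.1 \in GG).
  have [-> ->] := fG v vz vG; have [fuG _] := f2N u uz uG.
  by have [_ ->] := C_cut i fuG vG (f2 u uz).
have cw w : w \in z -> w.1 \notin GG -> c i w.1 = c i (f w).
  by move=> wz wG; rewrite cf// (C_c i wG (Cz w wz)).
have cuv : c i u.1 = c i v.1 by rewrite !cw.
rewrite /f /mv uG vG /= -cuv; case: ifP => // /asboolP notfree.
have [//|[s [t [sm sG st]]]] := GP i (c i u.1).
have [e|ne] := eqVneq u.1 v.1.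
  by rewrite -e (iffLR (eqz u v uz vz) e) !ltnn.
have ne2 : u.2 != v.2 by apply: contraNneq ne => /(iffRL (eqz u v uz vz)) ->.
have [_ uG2] := f2N u uz uG; have [_ vG2] := f2N v vz vG.
rewrite -!st ?notin_y//; last 2 first.
- by rewrite (C_c i uG (Cz u uz)).
- by rewrite cuv (C_c i vG (Cz v vz)).
suff -> : tp (fill s u.1 v.1) = tp (fill s u.2 v.2) by [].
(* If the refined colours agree, the chain [ord0] will do, because its ranking is the one used in
   the refinement. Otherwise the refined colours force the order in some chain, or make it
   irrelevant there. *)
have [j jP] : exists j, c j u.1 = c j v.1 -> (r j u.1 < r j v.1) = (r j u.2 < r j v.2)
    /\ (r j v.1 < r j u.1) = (r j v.2 < r j u.2).
  have [eC|neC] := eqVneq (C u.1) (C v.1).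
    exists ord0 => _; have [_ h] := simz u v uz vz; have [_ h'] := simz v u vz uz.
    by rewrite h// h'.
  have [j jP] := C_neq uG vG (elimN eqP neC).
  exists j => cj; case: jP => [//|[g gG]].
  have [] := C_cut j uG gG (Cz u uz); have [] := C_cut j vG gG (Cz v vz).
  move: (r j u.1) (r j v.1) (r j u.2) (r j v.2) (r j g) => a b a' b' d.
  by clear; lia.
pose F (a : T + bool) := (match a with inl t => t | inr b => if b then u.1 else v.1 end,
  match a with inl t => t | inr b => if b then u.2 else v.2 end).
have -> : fill s u.1 v.1 = unzip1 (map F s) by rewrite /fill /unzip1 -map_comp.
have -> : fill s u.2 v.2 = unzip2 (map F s) by rewrite /fill /unzip2 -map_comp.
have {}[_ hom] := chainP j; apply: hom; first by rewrite size_map.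
  move=> _ /mapP[[a|b] as_ ->] /=.
    by rewrite !inE; split; apply: contraTneq (sG _ as_) => ->.
  by case: b {as_}; split; apply: notin_y1.
have cj w : w \in z -> w.1 \notin GG -> c j w.1 = c j w.2.
  by move=> wz wG; apply: C_c wG (Cz w wz).
move=> _ _ /mapP[a as_ ->] /mapP[b bs ->]; split.
  by case: a as_ => //= -[] _; apply: cj.
have inG a0 : inl a0 \in s -> a0 \in GG by move=> /sG /(subsetP (GGG i)).
case: a as_ => [a|a] as_; case: b bs => [b|b] bs //=.
- by case: b bs => _ _; [have [] := C_cut j uG (inG _ as_) (Cz u uz)
                        |have [] := C_cut j vG (inG _ as_) (Cz v vz)].
- by case: a as_ => _ _; [have [] := C_cut j uG (inG _ bs) (Cz u uz)
                        |have [] := C_cut j vG (inG _ bs) (Cz v vz)].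
- case: a b {as_ bs} => -[]; rewrite ?ltnn// => cjuv.
    by have [] := jP cjuv.
  by have [] := jP (esym cjuv).
Qed.

End Refine.

Lemma critical_chainable p : exists p', forall (T : finType) (tp : seq T -> K),
  (forall y, chainable m tp [set~ y] p) -> chainable m tp setT p'.
Proof.
(* [g] bounds the parameters of one chain over its [p.+1] classes, and [gm] bounds the [n0.+1]
   points together with all their parameters. *)
pose n0 := 2 * m; pose g := p.+1 * (3 * m); pose gm := n0.+1 * g.+1.
pose Col : finType :=
  ('I_gm.+1 + {ffun 'I_n0.+1 -> 'I_p.+1 * {ffun 'I_gm.+1 -> bool * bool}})%type.
(* The first bound is the size required for [n0.+1] independent points; below it each element gets
   its own colour. *)
exists (maxn (n0.+1 * (2 * g).+1) #|Col|) => T tp ch.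
have [small|big] := leqP #|T| (n0.+1 * (2 * g).+1).
  by apply: small_chainable; rewrite cardsT leqW// (leq_trans small)// leq_maxl.
have /choice[cr crP] y : exists cr : (T -> 'I_p.+1) * (T -> nat),
    chain m tp [set~ y] cr.1 cr.2.
  by have [c [r h]] := ch y; exists (c, r).
pose pure y k (G : {set T}) :=
  {in [set~ y] :\: G &, forall x x', (cr y).1 x = k -> (cr y).1 x' = k ->
     interchangeable m tp [set~ y] x x'} \/
  exists s t, [/\ size s <= m, forall a, inl a \in s -> a \in G &
      {in [set~ y] :\: G &, forall x x', (cr y).1 x = k -> (cr y).1 x' = k -> x != x' ->
         (tp (fill s x x') == t) = ((cr y).2 x < (cr y).2 x')}].
(* Adding parameters preserves the dichotomy, so one set can serve all classes of a chain. *)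
have pureS y k (G G' : {set T}) : G \subset G' -> pure y k G -> pure y k G'.
  move=> GG'; have sD : [set~ y] :\: G' \subset [set~ y] :\: G by apply: setDS.
  case=> [h|[s [t [sm sG h]]]]; [left|right; exists s, t; split=> //].
  - by move=> x x' /(subsetP sD) xG /(subsetP sD) x'G; apply: h.
  - by move=> a /sG /(subsetP GG').
  - by move=> x x' /(subsetP sD) xG /(subsetP sD) x'G; apply: h.
have /choice[G GP] y : exists G : {set T},
    [/\ G \subset [set~ y], #|G| <= g & forall k, pure y k G].
  have /choice[Gk GkP] k : exists G : {set T},
      [/\ G \subset [set~ y], #|G| <= 3 * m & pure y k G].
    exact: class_dichotomy (crP y).
  exists (\bigcup_k Gk k); split.
  - by apply/bigcupsP => k _; have [] := GkP k.
  - have := @card_bigcup_leq _ _ predT Gk (3 * m).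
    by rewrite (eq_card (B := 'I_p.+1))// card_ord; apply=> k; have [] := GkP k.
  - by move=> k; have [_ _] := GkP k; apply: pureS; apply: bigcup_sup.
have [||B [_ cB indB]] := @independent_set _ G g n0.+1 setT.
- by move=> y; have [] := GP y.
- by rewrite cardsT ltnW.
have y0 : T by apply: (enum_val (A := T)); apply: Ordinal (leq_ltn_trans (leq0n _) big).
pose y (i : 'I_n0.+1) := nth y0 (enum B) i.
have szB : size (enum B) = n0.+1 by rewrite -cardE.
have yB i : y i \in B by rewrite -mem_enum mem_nth// szB.
have yinj : injective y.
  move=> i j /eqP; rewrite nth_uniq ?szB ?enum_uniq// => /eqP; exact: val_inj.
pose GG := \bigcup_(x in B) (x |: G x).
apply: (@chain_chainable _ _ _ _ _ Col); last first.
  apply: (@chain_refine _ tp p n0 gm y (fun i => (cr (y i)).1)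
    (fun i => (cr (y i)).2) (fun i => G (y i)) GG) => //.
  - rewrite /gm -cB; apply: (@card_bigcup_leq _ _ (mem B)) => x.
    rewrite cardsU1 -add1n leq_add ?leq_b1//.
    by have [] := GP x.
  - by move=> i; apply: subset_trans (bigcup_sup (y i) (yB i)); apply: subsetUr.
  - by move=> i; apply/bigcupP; exists (y i); rewrite // setU11.
  - move=> i j; have [->|ne] := eqVneq i j.
      have [/subsetP sG _ _] := GP (y j); apply/negP => /sG.
      by rewrite !inE eqxx.
    by apply: indB; rewrite ?yB// (inj_eq yinj).
  - by move=> i k; have [_ _ h] := GP (y i); exact: h.
by rewrite ltnW// ltnS leq_maxr.
Qed.

End Critical.

(** * Bounded obstructions to being a chain *)

(** Colours and ranking are pulled back along [f], which embeds one substructure into the other. *)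
Lemma chainable_transport (K : finType) m p (T T' : finType) (tp : seq T -> K)
    (tp' : seq T' -> K) (f : T -> T') (D : {set T}) (D' : {set T'}) :
  {in D &, injective f} -> {in D, forall x, f x \in D'} ->
  (forall s, size s <= m -> {subset s <= D} -> tp' (map f s) = tp s) ->
  chainable m tp' D' p -> chainable m tp D p.
Proof.
move=> finj fD ftp [c [r [inj hom]]]; exists (c \o f), (r \o f); split.
  by move=> x y xD yD /= e1 e2; apply: finj => //; apply: inj => //; apply: fD.
move=> z sz zD simz; rewrite -!ftp ?size_map//; last first.
- by move=> _ /mapP[u /zD[? _] ->].
- by move=> _ /mapP[u /zD[_ ?] ->].
pose z' := [seq (f u.1, f u.2) | u <- z].
have -> : map f (unzip1 z) = unzip1 z' by rewrite /unzip1 -!map_comp.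
have -> : map f (unzip2 z) = unzip2 z' by rewrite /unzip2 -!map_comp.
apply: hom; first by rewrite size_map.
  by move=> _ /mapP[u /zD[? ?] ->]; split; apply: fD.
by move=> _ _ /mapP[u uz ->] /mapP[v vz ->]; apply: simz.
Qed.

(** * Patterns of tuples and embeddings between chains *)

Section Pattern.
Variables (m : nat) (Col : finType).

(** Similarity classes of tuples are made into a finite type. In [pat], [None] marks indices past
    the end, so that a pattern determines the length, and ranks are recorded only between entries of
    the same colour. *)
Definition pattern : finType := {ffun 'I_m -> {ffun 'I_m -> option (Col * bool)}}.

Definition pat (T : Type) (c : T -> Col) (r : T -> nat) (s : seq T) : pattern :=
  [ffun a : 'I_m => [ffun b : 'I_m => match onth s a, onth s b with
     | Some x, Some y => Some (c x, (c x == c y) && (r x < r y))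
     | _, _ => None end]].

Lemma pat_size (T T' : Type) (c : T -> Col) r (c' : T' -> Col) r' s s' :
  size s <= m -> size s' <= m -> pat c r s = pat c' r' s' -> size s = size s'.
Proof.
move=> sm s'm /ffunP e; apply/eqP; rewrite eqn_leq.
apply/andP; split; rewrite leqNgt; apply/negP => lt.
  have := e (Ordinal (leq_trans lt sm)); rewrite !ffunE.
  move=> /ffunP /(_ (Ordinal (leq_trans lt sm))); rewrite !ffunE /=.
  by rewrite (onth_default (leqnn _)); move: lt; rewrite -onthTE; case: onth.
have := e (Ordinal (leq_trans lt s'm)); rewrite !ffunE.
move=> /ffunP /(_ (Ordinal (leq_trans lt s'm))); rewrite !ffunE /=.
by rewrite (onth_default (leqnn _)); move: lt; rewrite -onthTE; case: onth.
Qed.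

Lemma pat_sim (T T' : eqType) (c : T -> Col) r (c' : T' -> Col) r'
    (z : seq (T * T')) : size z <= m ->
  pat c r (unzip1 z) = pat c' r' (unzip2 z) <-> sim c r c' r' z.
Proof.
move=> zm; split=> [/ffunP e|simz].
  have key u v : u \in z -> v \in z -> c u.1 = c' u.2 /\
      (c u.1 == c v.1) && (r u.1 < r v.1) = (c' u.2 == c' v.2) && (r' u.2 < r' v.2).
    move=> /onthP[a ua] /onthP[b vb].
    have lt i w : onth z i = Some w -> i < m.
      by move=> h; rewrite (leq_trans _ zm)// -onthTE h.
    have := e (Ordinal (lt _ _ ua)); rewrite !ffunE.
    move=> /ffunP /(_ (Ordinal (lt _ _ vb))); rewrite !ffunE /=.
    by rewrite /unzip1 /unzip2 !onth_map ua vb /= => -[-> ->].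
  move=> u v uz vz; have [eu euv] := key u v uz vz; split=> // ec.
  have [ev _] := key v u vz uz.
  by move: euv; rewrite -eu -ev ec eqxx.
apply/ffunP => a; rewrite !ffunE; apply/ffunP => b; rewrite !ffunE.
rewrite /unzip1 /unzip2 !onth_map.
case ua: (onth z a) => [u|//]; case vb: (onth z b) => [v|//] /=.
have uz : u \in z by apply/onthP; exists a.
have vz : v \in z by apply/onthP; exists b.
have [eu euv] := simz u v uz vz; have [ev _] := simz v v vz vz.
rewrite eu ev; congr (Some (_, _)); case: eqP => //= ec.
by apply: euv; rewrite eu ev.
Qed.

Lemma pat_simP (T T' : eqType) (c : T -> Col) r (c' : T' -> Col) r' s s' :
  size s <= m -> size s' <= m -> pat c r s = pat c' r' s' ->
  exists z, [/\ s = unzip1 z, s' = unzip2 z & sim c r c' r' z].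
Proof.
move=> sm s'm e; have se := pat_size sm s'm e.
exists (zip s s'); rewrite unzip1_zip ?unzip2_zip ?se//; split=> //.
by apply/pat_sim; rewrite ?size_zip ?se ?minnn// unzip1_zip ?unzip2_zip ?se.
Qed.

(** Similar tuples have the same type, so [tp] factors through patterns; a pattern that is not
    realised gets the arbitrary value [tp [::]]. *)
Lemma chain_pat (K : finType) (T : finType) (tp : seq T -> K) (c : T -> Col) r :
  chain m tp setT c r -> exists kap : {ffun pattern -> K},
    forall s, size s <= m -> kap (pat c r s) = tp s.
Proof.
move=> [_ hom].
have /choice[kap kapP] q : exists t, forall s, size s <= m -> pat c r s = q -> tp s = t.
  have [[s0 [s0m s0q]]|no] := pselect (exists s, size s <= m /\ pat c r s = q).
    exists (tp s0) => s sm; rewrite -s0q => /(pat_simP sm s0m)[z [-> e2 simz]].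
    by rewrite e2; apply: hom; rewrite // -(size_map snd) -/unzip2 -e2.
  by exists (tp [::]) => s sm sq; case: no; exists s.
by exists (finfun kap) => s sm; rewrite ffunE (kapP (pat c r s)).
Qed.

(** Each element goes to the element of the same rank in the class of the same colour. *)
Lemma matching (T T' : finType) (c : T -> Col) r (c' : T' -> Col) r' :
  (forall x y, c x = c y -> r x = r y -> x = y) ->
  (forall x y, c' x = c' y -> r' x = r' y -> x = y) ->
  (forall k, #|[set x | c x == k]| <= #|[set x | c' x == k]|) ->
  exists2 f : T -> T', injective f &
    forall x y, c' (f x) = c x /\ (c x = c y -> (r' (f x) < r' (f y)) = (r x < r y)).
Proof.
move=> inj inj' le.
have rinj k : {in [set x | c x == k] &, injective r}.
  by move=> x y; rewrite !inE => /eqP cx /eqP cy; apply: inj; rewrite cx cy.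
have rinj' k : {in [set x | c' x == k] &, injective r'}.
  by move=> x y; rewrite !inE => /eqP cx /eqP cy; apply: inj'; rewrite cx cy.
have /choice[f fP] x : exists y,
    c' y = c x /\ rank [set y | c' y == c x] r' y = rank [set y | c y == c x] r x.
  have [|y] := @rank_onto _ _ r' (rinj' (c x)) (rank [set y | c y == c x] r x).
    by rewrite (leq_trans _ (le (c x)))// rank_lt ?inE.
  by rewrite inE => /eqP cy ry; exists y.
have mono x y : c x = c y -> (r' (f x) < r' (f y)) = (r x < r y).
  move=> cxy; have [cfx rx] := fP x; have [cfy ry] := fP y.
  rewrite -(rankE (@rinj (c x))) ?inE ?cxy// -(rankE (@rinj' (c x))) ?inE ?cfx ?cfy ?cxy//.
  by rewrite -cxy rx cxy ry.
exists f => [x y e|x y]; last by split; [case: (fP x)|apply: mono].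
have cxy : c x = c y by have [<- _] := fP x; have [<- _] := fP y; rewrite e.
apply: inj => //; have := mono x y cxy; have := mono y x (esym cxy).
by rewrite e ltnn; case: ltngtP.
Qed.

End Pattern.

Lemma nat_monotone_subseq (f : nat -> nat) : exists sg : nat -> nat,
  {homo sg : i j / i < j} /\ {homo f \o sg : i j / i <= j}.
Proof.
(* [h n] is a place where [f] attains its minimum on the indices from [n] on. Iterating [h] gives
   the subsequence. *)
have /choice[h hP] n : exists k, n <= k /\ forall j, n <= j -> f k <= f j.
  pose P v := `[< exists k, n <= k /\ f k = v >].
  have exP : exists v, P v by exists (f n); apply/asboolP; exists n.
  case: (ex_minnP exP) => v /asboolP[k [nk fk]] minv; exists k; split=> // j nj.
  by rewrite fk; apply: minv; apply/asboolP; exists j.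
pose sg := fix sg i := if i is i'.+1 then h (sg i').+1 else h 0.
have sgS i : sg i < sg i.+1 by have [le _] := hP (sg i).+1; exact: le.
have sgm : {homo sg : i j / i < j} by apply: homo_ltn => // a b d; apply: ltn_trans.
exists sg; split=> // i j; rewrite leq_eqVlt => /predU1P[->//|lt] /=.
case: i lt => [|i] lt; first by have [_ min] := hP 0; apply: min.
have [_ min] := hP (sg i).+1; apply: min.
exact: sgm (ltnW lt).
Qed.

Lemma dickson_seq (I : eqType) (ks : seq I) (f : nat -> I -> nat) :
  exists sg : nat -> nat, {homo sg : i j / i < j} /\
    {in ks, forall k i j, i <= j -> f (sg i) k <= f (sg j) k}.
Proof.
elim: ks => [|k ks [sg [sgm IH]]]; first by exists id; split=> [i j|k]; rewrite ?in_nil.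
have [tau [taum tauP]] := nat_monotone_subseq (fun i => f (sg i) k).
exists (sg \o tau); split=> [i j /taum/sgm//|k']; rewrite inE => /predU1P[->|k'ks] i j.
  exact: tauP.
move=> ij; apply: IH => //.
by move: ij; rewrite leq_eqVlt => /predU1P[->//|/taum/ltnW].
Qed.

(* Constancy of [g] is monotonicity of both [enum_rank \o g] and its
   complement, so that it is a special case of the statement for [f]. *)
Lemma dickson (I F : finType) (f : nat -> I -> nat) (g : nat -> F) :
  exists sg : nat -> nat, [/\ {homo sg : i j / i < j},
    forall k i j, i <= j -> f (sg i) k <= f (sg j) k &
    forall i j, g (sg i) = g (sg j)].
Proof.
have [N [e einj ltN]] : exists N, exists2 e : F -> nat, injective e & forall x, e x < N.
  exists #|F|, (fun x => nat_of_ord (enum_rank x)) => [x y|x]; last exact: ltn_ord.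
  by move=> /val_inj/enum_rank_inj.
pose f' n (k : bool + I) := match k with inr k => f n k
  | inl b => if b then e (g n) else N - e (g n) end.
have [sg [sgm h]] := dickson_seq (enum {: bool + I}) f'.
exists sg; split=> // [k i j ij|]; first by apply: (h (inr k)); rewrite ?mem_enum.
have key i j : i <= j -> g (sg i) = g (sg j).
  move=> ij; apply: einj.
  have := h (inl true); rewrite mem_enum => /(_ isT i j ij) /=.
  have := h (inl false); rewrite mem_enum => /(_ isT i j ij) /=.
  have := ltN (g (sg i)); have := ltN (g (sg j)).
  by clear; lia.
by move=> i j; have [/key//|/ltnW/key//] := leqP i j.
Qed.

(* Minimal non-chainable structures are chainable with more colours, hence
   well-quasi-ordered by embeddability, whereas they form an antichain. *)
Lemma chainable_bound (K : finType) m p : exists b, forall (T : finType) (tp : seq T -> K),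
  (forall D : {set T}, #|D| <= b -> chainable m tp D p) -> chainable m tp setT p.
Proof.
apply: contrapT => nob.
(* Minimal counterexamples are recoded on ordinals, so that a sequence of them can be chosen. *)
have /choice[S SP] b : exists S : {n & seq 'I_n -> K}, [/\ b < projT1 S,
    ~ chainable m (projT2 S) setT p &
    forall y, chainable m (projT2 S) [set~ y] p].
  apply: contrapT => noS; apply: nob; exists b => T tp small; apply: contrapT => nT.
  pose P n := `[< exists D : {set T}, ~ chainable m tp D p /\ #|D| = n >].
  have exP : exists n, P n by exists #|[set: T]|; apply/asboolP; exists setT.
  case: (ex_minnP exP) => n /asboolP[D [nD cD]] minn.
  have bD : b < #|D| by rewrite ltnNge; apply/negP => /small.
  have /card_gt0P[x0 x0D] : 0 < #|D| by apply: leq_ltn_trans bD.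
  apply: noS; exists (existT (fun n => seq 'I_n -> K) #|D|
    (fun s => tp (map (fun i => enum_val i) s))); split=> //=.
    move=> h; apply: nD; move: h.
    apply: (chainable_transport (f := enum_rank_in x0D)).
    - by apply: (can_in_inj (g := fun i => enum_val i)); apply: enum_rankK_in.
    - by move=> x _; rewrite inE.
    - move=> s _ sD; rewrite -map_comp map_id_in// => x /sD xD /=.
      exact: enum_rankK_in.
  move=> y; apply: (@chainable_transport _ _ _ _ _ _ tp (fun i => enum_val i)
    _ (D :\ enum_val y)) => //.
  - by move=> i j _ _; apply: enum_val_inj.
  - by move=> i; rewrite !inE (inj_eq enum_val_inj) enum_valP andbT.
  apply: contrapT => nDy; have := minn #|D :\ enum_val y|.
  rewrite -cD [#|D|](cardsD1 (enum_val y)) enum_valP ltnn => h.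
  by have : false by apply: h; apply/asboolP; exists (D :\ enum_val y).
have [p' pP] := @critical_chainable K m p.
have crE b : exists cr : ('I_(projT1 (S b)) -> 'I_p'.+1) *
    ('I_(projT1 (S b)) -> nat), chain m (projT2 (S b)) setT cr.1 cr.2.
  by have [_ _ /pP[c [r h]]] := SP b; exists (c, r).
pose cr b := projT1 (cid (crE b)).
have crP b : chain m (projT2 (S b)) setT (cr b).1 (cr b).2 := projT2 (cid (crE b)).
have /choice[kap kapP] b : exists kap : {ffun pattern m 'I_p'.+1 -> K},
    forall s, size s <= m -> kap (pat m (cr b).1 (cr b).2 s) = projT2 (S b) s.
  exact: chain_pat (crP b).
have [sg [sgm fP gP]] := dickson
  (fun b k => #|[set i | (cr b).1 i == k]|) kap.
(* Since [S b'] has more than [b'] points and [sg i] is at least [i], this index makes [S b'] larger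
   than [S b]. *)
pose b := sg 0; pose b' := sg (projT1 (S b)).
have leb : #|'I_(projT1 (S b))| < #|'I_(projT1 (S b'))|.
  rewrite !card_ord; have [lt _ _] := SP b'; apply: leq_ltn_trans lt.
  have le i : i <= sg i.
    by elim: i => // i; move/leq_ltn_trans; apply; apply: sgm.
  exact: le.
have inj b0 x y : (cr b0).1 x = (cr b0).1 y -> (cr b0).2 x = (cr b0).2 y -> x = y.
  by have [h _] := crP b0; apply: h; rewrite inE.
have [f finj fS] := matching (inj b) (inj b') (fun k => fP k 0 _ (leq0n _)).
(* The embedding misses a point [y], so [S b] embeds into a one-point-deleted substructure of
   [S b'], which is chainable. *)
have /subsetPn[y _ yP] : ~~ ([set: 'I_(projT1 (S b'))] \subset f @: setT).
  apply: contraTN leb => /subset_leq_card.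
  by rewrite cardsT card_imset// cardsT -leqNgt.
have [_ nb _] := SP b; have [_ _ /(_ y) chb'] := SP b'.
apply: nb; apply: chainable_transport chb' => [||s sm _].
- by move=> x x' _ _; apply: finj.
- move=> x _; rewrite !inE; apply: contraNneq yP => <-.
  by apply: imset_f; rewrite inE.
rewrite -(kapP b')// ?size_map// -(kapP b)// (gP 0 (projT1 (S b))); congr (kap _ _).
pose z := [seq (x, f x) | x <- s].
have -> : map f s = unzip2 z by rewrite /unzip2 -map_comp.
have e1 : unzip1 z = s by rewrite /unzip1 -map_comp map_id.
rewrite -[X in _ = pat _ _ _ X]e1; apply/esym/pat_sim; first by rewrite size_map.
move=> _ _ /mapP[u us ->] /mapP[v vs ->]; have [cu ru] := fS u v.
by split=> // e; rewrite ru.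
Qed.

(** * Homogeneous parts of large blocks *)

Lemma sum_count_fiber (X : Type) (K : finType) (col : X -> K) (s : seq X) :
  \sum_t count (fun x => col x == t) s = size s.
Proof.
elim: s => [|x s IH] /=; first by rewrite big1.
rewrite big_split /= IH (bigD1 (col x))//= eqxx big1// => t.
by rewrite eq_sym => /negPf->.
Qed.

(** Elements are picked greedily, the remainder being thinned each time by the case of [d], until
    the colour of a subsequence of length [d.+1] depends on its first element only. The pigeonhole
    principle on first elements finishes. *)
Lemma ramsey (K : finType) d n : exists N, forall (s : seq nat) (f : seq nat -> K),
  N <= size s -> exists h t, [/\ subseq h s, size h = n &
    forall u, subseq u h -> size u = d -> f u = t].
Proof.
elim: d n => [|d IHd] n.
  exists n => s f ns; exists (take n s), (f [::]).
  by rewrite take_subseq size_takel//; split=> // u _ /size0nil ->.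
have greedy e : exists N, forall (s : seq nat) (f : seq nat -> K), N <= size s ->
    exists h (col : nat -> K), [/\ subseq h s, size h = e &
      forall a u, subseq (a :: u) h -> size u = d -> f (a :: u) = col a].
  elim: e => [|e [N IHe]].
    by exists 0 => s f _; exists [::], (fun=> f [::]); rewrite sub0seq.
  have [M MP] := IHd N; exists M.+1 => -[//|a s] f; rewrite ltnS => Ms.
  have [h1 [t [h1s sh1 h1P]]] := MP s (fun u => f (a :: u)) Ms.
  have [|h2 [col [h2h1 sh2 h2P]]] := IHe h1 f; first by rewrite sh1.
  exists (a :: h2), (fun x => if x == a then t else col x); split.
  - by rewrite /= eqxx; apply: subseq_trans h1s.
  - by rewrite /= sh2.
  - move=> x u /=; case: (eqVneq x a) => [->|_] sub su; last exact: h2P.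
    by apply: h1P su; apply: subseq_trans h2h1.
have [N NP] := greedy (#|K| * n).+1; exists N => s f /(NP _ f)[h [col [hs sh hP]]].
have [t nt] : exists t, n <= count (fun x => col x == t) h.
  apply: contrapT => no; have := sum_count_fiber col h; rewrite sh => e.
  have : \sum_t count (fun x => col x == t) h <= \sum_(t : K) n.
    apply: leq_sum => t _; rewrite leqNgt; apply/negP => /ltnW le.
    by apply: no; exists t.
  by rewrite e sum_nat_const ltnn.
have sub : subseq (take n [seq x <- h | col x == t]) h.
  by apply: subseq_trans (take_subseq _ _) (filter_subseq _ _).
exists (take n [seq x <- h | col x == t]), t; split.
- exact: subseq_trans hs.
- by rewrite size_takel// size_filter.
- move=> [//|a u] sub' [su]; rewrite (hP a u)//; last exact: subseq_trans sub.
  have := mem_subseq sub' (mem_head _ _) => /mem_take.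
  by rewrite mem_filter => /andP[/eqP].
Qed.

Lemma sorted_subseq_iota P n : sorted ltn P -> all (fun i => i < n) P ->
  subseq P (iota 0 n).
Proof.
move=> sP /allP Pn.
suff -> : P = [seq i <- iota 0 n | i \in P] by apply: filter_subseq.
apply: (irr_sorted_eq ltn_trans ltnn) => //.
  exact: (subseq_sorted ltn_trans (filter_subseq _ _) (iota_ltn_sorted _ _)).
move=> i; rewrite mem_filter mem_iota /= add0n.
by case iP: (i \in P) => //=; rewrite Pn.
Qed.

Lemma subseq_map_nth (h P : seq nat) :
  sorted ltn P -> all (fun i => i < size h) P -> subseq (map (nth 0 h) P) h.
Proof.
move=> sP Ph; rewrite -[X in subseq _ X](mkseq_nth 0) /mkseq.
exact/map_subseq/sorted_subseq_iota.
Qed.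

Section Blocks.
Variables (K : finType) (m l : nat).

Definition block (T : finType) (v : T -> 'I_l) j : {set T} := [set x | v x == j].

(* All blocks are coloured along a common index set; Ramsey's theorem makes it
   homogeneous, and block [j] keeps only the indices of its [j]-th interval, so
   that the order of indices of distinct blocks is that of the blocks. *)
Lemma homogeneous_part q b : exists N, forall (T : finType) (x0 : T)
    (tp : seq T -> K) (v : T -> 'I_l),
  (forall j, #|block v j| <= q \/ N <= #|block v j|) ->
  exists H : {set T}, [/\ chainable m tp H (l * q + l),
    forall j, #|block v j| <= q -> block v j \subset H &
    forall j, q < #|block v j| -> b <= #|H :&: block v j|].
Proof.
(* An entry of a tuple is coded by its number among the elements of small blocks, or by its block
   and a place in an increasing sequence of indices. *)
pose code : finType := ('I_(l * q).+1 + 'I_l * 'I_m.+1)%type.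
(* One interval of [b] indices for each of the [l] blocks, and [m] spare indices to lengthen
   sequences to exactly [m]. *)
have [N NP] := ramsey {ffun m.-bseq code -> K} m (l * b + m).
exists N => T x0 tp v big.
pose F := [set x | #|block v (v x)| <= q].
have Fq : #|F| <= l * q.
  have : #|\bigcup_(j : 'I_l | #|block v j| <= q) block v j| <= l * q.
    apply: leq_trans (_ : \sum_(j | #|block v j| <= q) q <= _); last first.
      by rewrite sum_nat_const leq_mul2r (leq_trans (max_card _)) ?card_ord ?orbT.
    elim/big_rec2: _ => [|j a A jq leA]; first by rewrite cards0.
    by rewrite (leq_trans (leq_card_setU _ _))// leq_add.
  apply: leq_trans; apply: subset_leq_card; apply/subsetP => x; rewrite inE => xq.
  by apply/bigcupP; exists (v x); rewrite // inE.
have indexF x : x \in F -> index x (enum F) < (l * q).+1.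
  by move=> xF; rewrite ltnS (leq_trans _ Fq)// cardE ltnW// index_mem mem_enum.
pose el j i := nth x0 (enum (block v j)) i.
pose ix x := index x (enum (block v (v x))).
have elK x : el (v x) (ix x) = x by rewrite /el nth_index// mem_enum inE.
pose dec (u : seq nat) (a : code) := match a with
  | inl i => nth x0 (enum F) i | inr (j, k) => el j (nth 0 u k) end.
have [|h [t [hN sh hP]]] := NP (iota 0 N)
    (fun u => [ffun w : m.-bseq code => tp (map (dec u) w)]).
  by rewrite size_iota.
have hsort : sorted ltn h := subseq_sorted ltn_trans hN (iota_ltn_sorted _ _).
have hlt i : i \in h -> i < N by move=> /(mem_subseq hN); rewrite mem_iota.
have huniq : uniq h by apply: subseq_uniq hN (iota_uniq _ _).
pose ps x := index (ix x) h.
pose H := F :|: [set x | (ix x \in h) && (v x * b <= ps x < (v x).+1 * b)].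
have HP x : x \in H -> x \notin F -> ix x \in h /\ v x * b <= ps x < (v x).+1 * b.
  by rewrite in_setU => /orP[->//|]; rewrite inE => /andP[].
have psE x y : ix x \in h -> ix y \in h -> (ps x < ps y) = (ix x < ix y).
  move=> xh yh; rewrite -[ix x](nth_index 0 xh) -[ix y](nth_index 0 yh).
  rewrite -/(ps x) -/(ps y).
  have px : ps x \in [pred i | i < size h] by rewrite inE index_mem.
  have py : ps y \in [pred i | i < size h] by rewrite inE index_mem.
  have mono := sorted_ltn_nth ltn_trans 0 hsort.
  have [/mono->//|/mono lt|->] := ltngtP (ps x) (ps y); last by rewrite ltnn.
  by apply/esym/negbTE; rewrite -leqNgt ltnW// lt.
exists H; split; last 2 first.
- move=> j jq; apply/subsetP => x; rewrite inE => /eqP xj.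
  by rewrite !inE xj jq.
- move=> j qj; have Nj : N <= #|block v j| by case: (big j) qj => //; lia.
  have sub : {subset [seq el j (nth 0 h (j * b + i)) | i <- iota 0 b] <=
                enum (H :&: block v j)}.
    move=> x /mapP[i]; rewrite mem_iota /= add0n => ib ->.
    have ih : j * b + i < size h.
      rewrite sh; have : j.+1 * b <= l * b by rewrite leq_mul2r ltn_ord orbT.
      by move: ib; rewrite mulSn; clear; lia.
    have lt : nth 0 h (j * b + i) < size (enum (block v j)).
      by rewrite -cardE (leq_trans _ Nj)// hlt// mem_nth.
    have : el j (nth 0 h (j * b + i)) \in block v j by rewrite -mem_enum mem_nth.
    rewrite mem_enum in_setI => /[dup] + ->; rewrite inE => /eqP vj; rewrite andbT.
    rewrite in_setU; apply/orP; right; rewrite inE /ps /ix vj.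
    rewrite /el index_uniq ?enum_uniq// mem_nth//= index_uniq//.
    by rewrite leq_addr mulSn addnC ltn_add2r.
  rewrite -(size_iota 0 b) cardE -(size_map (fun i => el j (nth 0 h (j * b + i)))).
  apply: uniq_leq_size sub; rewrite map_inj_in_uniq ?iota_uniq// => i i'.
  rewrite !mem_iota /= !add0n => ib ib'.
  have ih k : k < b -> j * b + k < size h.
    move=> kb; rewrite sh; have : j.+1 * b <= l * b by rewrite leq_mul2r ltn_ord orbT.
    by move: kb; rewrite mulSn; clear; lia.
  have lt k : k < b -> nth 0 h (j * b + k) < size (enum (block v j)).
    by move=> kb; rewrite -cardE (leq_trans _ Nj)// hlt// mem_nth// ih.
  move=> /eqP; rewrite nth_uniq ?enum_uniq ?lt// nth_uniq ?ih// => /eqP.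
  by move/addnI.
(* A private colour for each element of a small block and one colour for each block:
   [(l * q + l).+1] in all. *)
pose c x : ('I_(l * q).+1 + 'I_l)%type :=
  if x \in F then inl (inord (index x (enum F))) else inr (v x).
have cF x y : x \in F -> c x = c y -> y = x.
  rewrite /c => xF; rewrite xF; case: ifP => // yF -[] /(congr1 (@nat_of_ord _)).
  rewrite !inordK ?indexF// => e.
  have := nth_index x (s := enum F) (x := y); rewrite -e mem_enum => <-//.
  by rewrite nth_index// mem_enum.
have c_in x y : c x = c y -> (y \in F) = (x \in F).
  by rewrite /c; case: ifP; case: ifP.
have c_v x y : x \notin F -> c x = c y -> v x = v y.
  by move=> xF e; move: (e); rewrite /c (c_in _ _ e) (negPf xF) => -[].
apply: (@chain_chainable _ _ _ _ _ _ c ix).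
  by rewrite card_sum !card_ord addSn.
split=> [x y _ _ e ixy|z sz zH simz].
  have [xF|xF] := boolP (x \in F); first by rewrite (cF _ _ xF e).
  by rewrite -(elK x) -(elK y) (c_v _ _ xF e) ixy.
have cz u : u \in z -> c u.1 = c u.2 by move=> uz; have [] := simz u u uz uz.
pose zs := sort (fun u u' => ps u.1 <= ps u'.1) (undup [seq u <- z | u.1 \notin F]).
have zsE u : (u \in zs) = (u \in z) && (u.1 \notin F).
  by rewrite mem_sort mem_undup mem_filter andbC.
have zsm : size zs <= m.
  apply: leq_trans sz; rewrite size_sort; apply: leq_trans (size_undup _) _.
  by rewrite size_filter count_size.
have zsH u : u \in zs -> [/\ ix u.1 \in h, ix u.2 \in h,
    v u.1 * b <= ps u.1 < (v u.1).+1 * b & v u.1 * b <= ps u.2 < (v u.1).+1 * b].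
  rewrite zsE => /andP[uz uF]; have [u1H u2H] := zH u uz.
  have [? ?] := HP _ u1H uF.
  have [] := HP _ u2H; first by rewrite (c_in _ _ (cz u uz)).
  by rewrite -(c_v _ _ uF (cz u uz)).
(* Between different blocks the order is that of their disjoint intervals; inside a block it comes
   from similarity. *)
have psz u u' : u \in zs -> u' \in zs -> (ps u.1 < ps u'.1) = (ps u.2 < ps u'.2).
  move=> uzs u'zs; have [h1 h2 i1 i2] := zsH u uzs; have [h1' h2' i1' i2'] := zsH u' u'zs.
  move: (uzs) (u'zs); rewrite !zsE => /andP[uz uF] /andP[u'z u'F].
  have [e|lt|gt] := ltngtP (v u.1) (v u'.1).
  - have le : (v u.1).+1 * b <= v u'.1 * b by rewrite leq_mul2r e orbT.
    by move: le i1 i2 i1' i2'; clear; lia.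
  - have le : (v u'.1).+1 * b <= v u.1 * b by rewrite leq_mul2r lt orbT.
    by move: le i1 i2 i1' i2'; clear; lia.
  - rewrite !psE//; have [_ ->//] := simz u u' uz u'z.
    by rewrite /c (negPf uF) (negPf u'F); congr inr; apply: val_inj.
have ps1_inj : {in zs &, injective (fun u => ps u.1)}.
  move=> u u' uzs u'zs e; move: (psz u u' uzs u'zs) (psz u' u u'zs uzs).
  rewrite e ltnn => /esym/negbT + /esym/negbT; rewrite -!leqNgt => le1 le2.
  have e2 : ps u.2 = ps u'.2 by apply/eqP; rewrite eqn_leq le1 le2.
  have [h1 h2 i1 i2] := zsH u uzs; have [h1' h2' i1' i2'] := zsH u' u'zs.
  have vv : v u.1 = v u'.1.
    apply: val_inj => /=; move: e i1 i1'; clear; move=> -> i1 i1'.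
    have [lt|gt|//] := ltngtP (v u.1) (v u'.1).
      have le : (v u.1).+1 * b <= v u'.1 * b by rewrite leq_mul2r lt orbT.
      by move: le i1 i1'; clear; lia.
    have le : (v u'.1).+1 * b <= v u.1 * b by rewrite leq_mul2r gt orbT.
    by move: le i1 i1'; clear; lia.
  move: (uzs) (u'zs); rewrite !zsE => /andP[uz uF] /andP[u'z u'F].
  have psinj x y : ix x \in h -> ix y \in h -> v x = v y -> ps x = ps y -> x = y.
    move=> xh yh vxy exy; rewrite -(elK x) -(elK y) vxy; congr (el _ _).
    by rewrite -(nth_index 0 xh) -(nth_index 0 yh) -/(ps x) -/(ps y) exy.
  case: u u' uF u'F uz u'z vv e e2 h1 h2 h1' h2' {uzs u'zs i1 i1' i2 i2' le1 le2} =>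
    [u1 u2] [u1' u2'] /= uF u'F uz u'z vv e e2 h1 h2 h1' h2'.
  rewrite (psinj u1 u1')// (psinj u2 u2')//.
  by rewrite -(c_v _ _ uF (cz _ uz)) -(c_v _ _ u'F (cz _ u'z)).
have sort1 : sorted ltn (map (fun u => ps u.1) zs).
  rewrite ltn_sorted_uniq_leq map_inj_in_uniq// sort_uniq undup_uniq /=.
  by rewrite sorted_map; apply: sort_sorted => u u'; apply: leq_total.
have sort2 : sorted ltn (map (fun u => ps u.2) zs).
  rewrite sorted_map; move: sort1; rewrite sorted_map.
  rewrite (@eq_in_sorted _ (mem zs) _ (relpre (fun u => ps u.2) ltn))//.
pose tail := iota (l * b) (m - size zs).
pose U (k : T * T -> nat) := map (nth 0 h) (map k zs ++ tail).
have UP k : sorted ltn (map k zs) -> {in zs, forall u, k u < l * b} ->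
    [ffun w : m.-bseq code => tp (map (dec (U k)) w)] = t.
  move=> ks kb; apply: hP; last first.
    by rewrite size_map size_cat size_map size_iota subnKC.
  apply: subseq_map_nth; last first.
    rewrite all_cat sh; apply/andP; split; apply/allP => i.
      by move=> /mapP[u /kb lt ->]; apply: leq_trans lt (leq_addr _ _).
    rewrite mem_iota => /andP[_ lt]; apply: leq_trans lt _.
    by rewrite leq_add2l leq_subr.
  move: ks; rewrite !(sorted_pairwise ltn_trans) pairwise_cat => ->.
  rewrite -(sorted_pairwise ltn_trans) iota_ltn_sorted !andbT.
  apply/allrelP => i j /mapP[u /kb lt ->]; rewrite mem_iota => /andP[le _].
  exact: leq_trans lt le.
have lb u : u \in zs -> ps u.1 < l * b /\ ps u.2 < l * b.
  move=> /zsH[_ _ /andP[_ i1] /andP[_ i2]].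
  by split; [apply: leq_trans i1 _|apply: leq_trans i2 _];
    rewrite leq_mul2r ltn_ord orbT.
have U1 := UP (fun u => ps u.1) sort1 (fun u uz => proj1 (lb u uz)).
have U2 := UP (fun u => ps u.2) sort2 (fun u uz => proj2 (lb u uz)).
(* One code serves both tuples: decoded along the indices of the first components it gives
   [unzip1 z], along those of the second components [unzip2 z]. Homogeneity equates the two
   types. *)
pose enc (u : T * T) : code := if u.1 \in F then inl (inord (index u.1 (enum F)))
  else inr (v u.1, inord (index u zs)).
have szenc : size (map enc z) <= m by rewrite size_map.
have := congr1 (fun g : {ffun m.-bseq code -> K} => g (Bseq szenc)) (etrans U1 (esym U2)).
rewrite !ffunE /= -!map_comp.
have decE (k : T * T -> nat) u : u \in z -> u.1 \notin F ->
    dec (U k) (enc u) = el (v u.1) (nth 0 h (k u)).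
  move=> uz uF; have uzs : u \in zs by rewrite zsE uz uF.
  rewrite /enc (negPf uF) /= inordK; last first.
    by rewrite ltnS (leq_trans _ zsm)// ltnW// index_mem.
  rewrite /U map_cat nth_cat !size_map index_mem uzs.
  rewrite (nth_map 0) ?size_map ?index_mem//.
  by rewrite (nth_map u) ?index_mem// nth_index.
have -> : map (dec (U (fun u => ps u.1)) \o enc) z = unzip1 z.
  apply/eq_in_map => u uz /=; have [uF|uF] := boolP (u.1 \in F).
    by rewrite /enc uF /= inordK ?indexF// nth_index// mem_enum.
  have uzs : u \in zs by rewrite zsE uz uF.
  by have [uh _ _ _] := zsH u uzs; rewrite decE// nth_index// elK.
have -> // : map (dec (U (fun u => ps u.2)) \o enc) z = unzip2 z.
apply/eq_in_map => u uz /=; have [uF|uF] := boolP (u.1 \in F).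
  by rewrite /enc uF /= inordK ?indexF// nth_index ?mem_enum// (cF _ _ uF (cz u uz)).
have uzs : u \in zs by rewrite zsE uz uF.
have [_ uh _ _] := zsH u uzs; rewrite decE// nth_index//.
by rewrite (c_v _ _ uF (cz u uz)) elK.
Qed.

(** [A] and [B] have equally many elements, so an injection suffices. Blocks may be empty. *)
Definition mondec (T : finType) (tp : seq T -> K) (v : T -> 'I_l) : Prop :=
  forall A B : {set T}, (forall j, #|A :&: block v j| = #|B :&: block v j|) ->
  exists f : T -> T, [/\ {in A &, injective f}, {in A, forall x, f x \in B} &
    forall s, size s <= m -> {subset s <= A} -> tp (map f s) = tp s].

Lemma subset_card_eq (T : finType) (A : {set T}) n : n <= #|A| ->
  exists2 B : {set T}, B \subset A & #|B| = n.
Proof.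
move=> nA; exists [set x in take n (enum A)].
  by apply/subsetP => x; rewrite inE => /mem_take; rewrite mem_enum.
rewrite cardsE (card_uniqP _) ?take_uniq ?enum_uniq//.
by rewrite size_takel// -cardE.
Qed.

(* Either every block larger than [q] is large enough to contain a homogeneous
   part, onto which bounded sets can be moved, or the size of one of them is
   bounded, and [q] can be raised above it. *)
Lemma mondec_chainable_aux k q : exists p, forall (T : finType)
    (tp : seq T -> K) (v : T -> 'I_l), mondec tp v ->
  #|[set j | q < #|block v j|]| <= k -> chainable m tp setT p.
Proof.
elim: k q => [|k IHk] q.
  exists (l * q) => T tp v _; rewrite leqn0 cards_eq0 => /eqP big0.
  apply: small_chainable; rewrite leqW//.
  have -> : [set: T] = \bigcup_(j : 'I_l) block v j.
    by apply/setP => x; rewrite inE; apply/esym/bigcupP; exists (v x); rewrite ?inE.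
  have := @card_bigcup_leq _ _ predT (block v) q.
  rewrite (eq_card (B := 'I_l))// card_ord; apply=> j.
  by rewrite leqNgt; apply/negP => qj; have := in_set0 j; rewrite -big0 inE qj.
have [b bP] := @chainable_bound K m (l * q + l).
have [N NP] := homogeneous_part q b.
have [p pP] := IHk (maxn q N).
exists (maxn (l * q + l) p) => T tp v mon bigk.
have [/card_gt0P[x0 _]|T0] := ltnP 0 #|T|; last first.
  by apply: small_chainable; rewrite cardsT (leq_trans T0).
have [gap|] := pselect (forall j, #|block v j| <= q \/ N <= #|block v j|).
  have [H [chH smallH bigH]] := NP T x0 tp v gap.
  apply: chainableW (leq_maxl _ _) _; apply: bP => D Db.
  (* [D] is replaced by a subset of [H] with the same trace sizes: small blocks already lie in [H],
     and large ones leave at least [b] elements there. *)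
  have /choice[B BP] j : exists B : {set T},
      B \subset H :&: block v j /\ #|B| = #|D :&: block v j|.
    have [jq|qj] := leqP #|block v j| q.
      exists (D :&: block v j); split=> //; rewrite subsetI subsetIr andbT.
      by apply: subset_trans (smallH j jq); apply: subsetIr.
    have [|B BH cB] := @subset_card_eq _ (H :&: block v j) #|D :&: block v j|.
      apply: leq_trans (bigH j qj); apply: leq_trans Db.
      by apply: subset_leq_card; apply: subsetIl.
    by exists B.
  have BI j : (\bigcup_i B i) :&: block v j = B j.
    have [/subsetP BjH _] := BP j.
    apply/setP => x; rewrite in_setI; apply/andP/idP => [[/bigcupP[i _ xi]]|xj].
      rewrite inE => /eqP <-; have [/subsetP BiH _] := BP i.
      by have := BiH x xi; rewrite !inE => /andP[_ /eqP ->].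
    split; first by apply/bigcupP; exists j.
    by have := BjH x xj; rewrite in_setI => /andP[].
  have [j|f [finj fB ftp]] := mon D (\bigcup_i B i).
    by rewrite BI; have [_ ->] := BP j.
  apply: chainable_transport finj _ ftp chH => x /fB /bigcupP[i _ xi].
  by have [/subsetP /(_ _ xi)] := BP i; rewrite in_setI => /andP[].
(* Block [j] has size strictly between [q] and [N], so raising the threshold to [maxn q N] removes
   it from the count. *)
move=> /existsNP[j /not_orP[/negP]]; rewrite -ltnNge => qj /negP; rewrite -ltnNge => jN.
apply: chainableW (leq_maxr _ _) _; apply: (pP T tp v mon).
rewrite -ltnS; apply: leq_trans bigk; apply: proper_card; apply/properP; split.
  by apply/subsetP => i; rewrite !inE gtn_max => /andP[].
by exists j; rewrite !inE// gtn_max negb_and -!leqNgt (ltnW jN) orbT.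
Qed.

Lemma mondec_chainable : exists p, forall (T : finType) (tp : seq T -> K)
  (v : T -> 'I_l), mondec tp v -> chainable m tp setT p.
Proof.
have [p pP] := mondec_chainable_aux l 0; exists p => T tp v mon.
by apply: (pP T tp v mon); rewrite (leq_trans (max_card _))// card_ord.
Qed.

End Blocks.

From mathcomp Require Import classical_sets functions cardinality.

(** * Relational structures *)

Lemma enum_of_finite_set T (A : set T) : finite_set A ->
  exists n (g : 'I_n -> {x : T | x \in A}), bijective g.
Proof.
move=> [n]; rewrite (card_eqr card_II) card_eq_sym => /card_bijP[f fbij].
exists n, (fun i => f (SigSub (mem_set (I : [set: 'I_n]%classic i)))).
case: fbij => f' f'K fK; exists (fun x => val (f' x)) => x; first by rewrite f'K.
by rewrite -[RHS]fK; congr f; apply: val_inj.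
Qed.

Lemma enum_of_finite_type T : finite_set [set: T] ->
  exists n (g : 'I_n -> T), bijective g.
Proof.
move=> /enum_of_finite_set[n [g [g' gK g'K]]]; exists n, (fun i => val (g i)).
exists (fun x => g' (exist _ x (in_setT x))) => x; last by rewrite g'K.
by rewrite -[RHS]gK; congr g'; apply: val_inj.
Qed.

(** Turns the equinumerosity conditions of monomorphic decompositions into equations between
    numbers. *)
Lemma card_eq_finset (T T' : finType) (X : {set T}) (Y : {set T'}) :
  ([set` X]%classic #= [set` Y]%classic)%card <-> #|X| = #|Y|.
Proof.
have h (U : finType) (Z : {set U}) : ([set` Z]%classic #= `I_#|Z|)%card.
  rewrite (card_eqr card_II) card_eq_sym.
  have := @inj_card_eq _ _ [set: 'I_#|Z|]%classic (fun i => enum_val i : U).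
  have -> : ((fun i => enum_val i : U) @` [set: 'I_#|Z|])%classic = [set` Z]%classic.
    apply/seteqP; split=> [_ [i _ <-]|x /= xZ]; first exact: enum_valP.
    by exists (enum_rank_in xZ x); rewrite ?enum_rankK_in.
  by rewrite card_eq_sym; apply=> i j _ _; apply: enum_val_inj.
rewrite (card_eql (h _ X)) (card_eqr (h _ Y)).
by split=> [/card_eq_II|e]; last apply/card_eq_II.
Qed.

Lemma card_fiber (T : finType) U (A V : set U) (g : T -> {x : U | x \in A}) :
  bijective g ->
  ((A `&` V)%classic #= [set` [set i | `[< V (val (g i)) >]]%SET]%classic)%card.
Proof.
move=> [g' gK g'K]; rewrite card_eq_sym.
have -> : (A `&` V = (val \o g) @` [set` [set i | `[< V (val (g i)) >]]%SET])%classic.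
  apply/seteqP; split=> [x [Ax Vx]|_ [i + <-]].
    exists (g' (exist _ x (mem_set Ax))); rewrite /= ?g'K//.
    by rewrite finset.inE; apply/asboolP; rewrite g'K.
  by rewrite /= finset.inE => /asboolP Vi; split=> //; apply/set_mem/(valP (g i)).
rewrite card_eq_sym; apply: inj_card_eq => i j _ _ /= /val_inj.
exact: (can_inj gK).
Qed.

Section Structures.
Variables (I : finType) (mu : I -> nat).
Implicit Types (R S : structure mu).

Let K : finType := {ffun I -> bool}.
Let m := \max_i mu i.

(** Encodes all relations by one map on sequences of any length; a sequence of the wrong length
    satisfies no relation of that arity. *)
Definition tuple_type R (s : seq R) : {ffun I -> bool} :=
  [ffun i => `[< exists t : (mu i).-tuple R, tval t = s /\ rel_of t >]].

Lemma tuple_typeP R i (t : (mu i).-tuple R) : rel_of t <-> tuple_type t i.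
Proof.
rewrite ffunE; split=> [ht|/asboolP[t' [e ht']]]; first by apply/asboolP; exists t.
by rewrite -(val_inj e : t' = t).
Qed.

Lemma tuple_type_size R (s : seq R) i : tuple_type s i -> size s = mu i.
Proof. by rewrite ffunE => /asboolP[t [<- _]]; rewrite size_tuple. Qed.

Definition rel_preserving R S (h : R -> S) : Prop :=
  forall i (t : (mu i).-tuple R), rel_of t <-> rel_of (map_tuple h t).

Lemma rel_preservingP R S (h : R -> S) : rel_preserving h <->
  forall s, size s <= m -> tuple_type (map h s) = tuple_type s.
Proof.
split=> [hh s _|hh i t]; last first.
  rewrite !tuple_typeP /= hh// size_tuple; exact: (@leq_bigmax _ mu i).
apply/ffunP => i; have [e|ne] := eqVneq (size s) (mu i); last first.
  by apply/idP/idP => /tuple_type_size; rewrite ?size_map => e; rewrite e eqxx in ne.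
pose t : (mu i).-tuple R := Tuple (introT eqP e).
have := hh i t; rewrite !tuple_typeP /= => -[h1 h2].
by apply/idP/idP.
Qed.

Lemma rel_preserving_comp R S (U : structure mu) (h : R -> S) (k : S -> U) :
  rel_preserving h -> rel_preserving k -> rel_preserving (k \o h).
Proof.
rewrite !rel_preservingP => hh hk s sm.
by rewrite map_comp hk ?size_map// hh.
Qed.

Lemma rel_preserving_val R (A : set R) :
  rel_preserving (fun x : induced A => val x).
Proof. by move=> i t. Qed.

Lemma isomorphic_sym R S : isomorphic R S -> isomorphic S R.
Proof.
move=> [f [g gK fK] /rel_preservingP hf]; exists g; first by exists f.
apply/rel_preservingP => s sm.
by rewrite -hf ?size_map// (mapK fK).
Qed.

Lemma isomorphic_trans R S (U : structure mu) :
  isomorphic R S -> isomorphic S U -> isomorphic R U.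
Proof.
move=> [f bf hf] [g bg hg]; exists (g \o f); first exact: bij_comp.
exact: rel_preserving_comp.
Qed.

Lemma isomorphic_image R S (h : R -> S) (A : set S) : injective h ->
  rel_preserving h -> (h @` setT)%classic = A -> isomorphic R (induced A).
Proof.
move=> inj hh imA.
have hA x : h x \in A by rewrite -imA; apply/mem_set; exists x.
have /choice[g gP] : forall y : {x : S | x \in A}, exists x, h x = val y.
  move=> y; have : (h @` setT)%classic (val y).
    by rewrite imA; apply/set_mem/(valP y).
  by move=> [x _ e]; exists x.
exists (fun x => exist _ (h x) (hA x)).
  exists g => x; first by apply: inj; rewrite gP.
  by apply: val_inj; rewrite /= gP.
move=> i t; rewrite hh.
by rewrite (_ : map_tuple h t = map_tuple val (map_tuple (fun x => exist _ (h x) (hA x)) t))//;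
  apply: val_inj; rewrite /= -map_comp.
Qed.

Lemma isomorphic_induced R S (h : R -> S) (B : set R) : injective h ->
  rel_preserving h -> isomorphic (induced B) (induced (h @` B)%classic).
Proof.
move=> inj hh.
apply: (@isomorphic_image _ _ (h \o (fun x : induced B => val x))).
- by move=> x y /inj/val_inj.
- apply: rel_preserving_comp hh; exact: rel_preserving_val.
apply/seteqP; split=> [_ [x _ <-]|_ [x Bx <-]].
  by exists (val x) => //; apply/set_mem/(valP x).
by exists (exist _ x (mem_set Bx)).
Qed.

Lemma hereditary_rel_preserving (C : structure mu -> Prop) R S (h : R -> S) :
  hereditary C -> injective h -> rel_preserving h -> C S -> C R.
Proof.
move=> her inj hh CS; apply: her CS _; exists (h @` setT)%classic.
exact: isomorphic_image hh _.
Qed.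

(** The blocks are the preimages of those of [V]; empty preimages are dropped, because the blocks of
    a partition are nonempty. *)
Lemma mondec_restrict (J : finType) R S (h : R -> S) (V : J -> set S) :
  injective h -> rel_preserving h -> monomorphic_decomposition V ->
  has_monomorphic_decomposition_le #|J| R.
Proof.
move=> inj hh [[cov tri _] mon].
pose P j := `[< exists x, V j (h x) >].
exists {j : J | P j}, (fun j x => V (val j) (h x)); split; last first.
  by rewrite card_sig max_card.
split; first split.
- apply/seteqP; split=> // x _; have : [set: S]%classic (h x) by [].
  rewrite -cov => -[j _ Vj].
  have Pj : P j by apply/asboolP; exists x.
  by exists (exist _ j Pj).
- by move=> i j _ _ [x [xi xj]]; apply/val_inj/tri => //; exists (h x).
- by move=> [j Pj] _; case: (asboolP _ Pj) => x xj; exists x.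
move=> A B finA finB AB.
apply: isomorphic_trans (isomorphic_induced _ inj hh) _.
apply: isomorphic_trans (isomorphic_sym (isomorphic_induced _ inj hh)).
apply: mon; [exact: finite_image|exact: finite_image|move=> j].
have im (D : set R) : (h @` D `&` V j = h @` (D `&` [set x | V j (h x)]))%classic.
  apply/seteqP; split=> [_ [[x Dx <-] Vx]|_ [x [Dx Vx] <-]]; first by exists x.
  by split=> //; exists x.
have inj' (D : set R) : {in D &, injective h} by move=> x y _ _; apply: inj.
rewrite !im (card_eql (inj_card_eq (inj' _))) (card_eqr (inj_card_eq (inj' _))).
have [Pj|nPj] := boolP (P j); first exact: (AB (exist _ j Pj)).
have e0 (D : set R) : (D `&` [set x | V j (h x)] = set0)%classic.
  by apply/seteqP; split=> // x [_ Vx]; case/negP: nPj; apply/asboolP; exists x.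
by rewrite !e0 card_eqxx.
Qed.

Lemma mondec_of_decomposition l n R (g : 'I_n -> R) : bijective g ->
  has_monomorphic_decomposition_le l R ->
  exists v : 'I_n -> 'I_l, mondec m (fun s => tuple_type (map g s)) v.
Proof.
move=> [g' gK g'K] [J [V [[[cov tri _] mon] Jl]]].
have ginj : injective g := can_inj gK.
have /choice[j jP] i : exists j, V j (g i).
  have : [set: R]%classic (g i) by [].
  by rewrite -cov => -[j _ Vj]; exists j.
have jE i k : V k (g i) -> j i = k by move=> Vk; apply: tri => //; exists (g i).
exists (fun i => widen_ord Jl (enum_rank (j i))) => A B AB.
pose im (D : {set 'I_n}) : set R := (g @` [set` D])%classic.
have finim D : finite_set (im D) by apply: finite_image.
have memim (D : {set 'I_n}) x : x \in im D -> g' x \in D.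
  by move=> /set_mem[i /= iD <-]; rewrite gK.
have imem (D : {set 'I_n}) i : i \in D -> g i \in im D.
  by move=> iD; apply/mem_set; exists i.
have imV D k : (im D `&` V k #=
    [set` D :&: block (fun i => widen_ord Jl (enum_rank (j i)))
                      (widen_ord Jl (enum_rank k))])%card%classic.
  rewrite -(card_eqr (inj_card_eq (f := g) _)); last by move=> x y _ _; apply: ginj.
  rewrite (_ : (g @` _)%classic = (im D `&` V k)%classic) ?card_eqxx//.
  apply/seteqP; split=> [_ [i /= + <-]|_ [[i /= iD <-] Vi]].
    rewrite finset.in_setI finset.inE => /andP[iD /eqP e].
    split; first by exists i.
    have <- : j i = k by apply/enum_rank_inj/val_inj; have [] := e.
    exact: jP.
  by exists i; rewrite //= finset.in_setI finset.inE iD (jE _ _ Vi) eqxx.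
have [f fbij hf] : isomorphic (induced (im A)) (induced (im B)).
  apply: mon => // k; rewrite (card_eql (imV A k)) (card_eqr (imV B k)).
  exact/card_eq_finset.
(* The isomorphism is carried to ordinals; outside [A] the value is arbitrary. *)
pose F i := match pselect (g i \in im A) with
  | left p => g' (val (f (exist _ (g i) p))) | right _ => i end.
have FE i (iA : i \in A) : F i = g' (val (f (exist _ (g i) (imem A i iA)))).
  rewrite /F; case: pselect => [p|]; last by move: (imem A i iA) => ? [].
  by congr (g' (val (f _))); apply: val_inj.
exists F; split.
- move=> i i' iA i'A; rewrite !FE => /(can_inj g'K)/val_inj/(bij_inj fbij).
  by move=> /(congr1 val) /= /ginj.
- by move=> i iA; rewrite FE; apply: memim; apply: valP.
move=> s sm sA.
have [s' es'] : exists s' : seq (induced (im A)), map val s' = map g s.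
  elim: s sA {sm} => [|i s IH] sA; first by exists [::].
  have [|s' es'] := IH; first by move=> x xs; apply: sA; rewrite inE xs orbT.
  by exists (exist _ (g i) (imem A i (sA i (mem_head _ _))) :: s'); rewrite /= es'.
have e2 : map g (map F s) = map val (map f s').
  have es : s = map (g' \o val) s'.
    by rewrite map_comp es' (mapK gK).
  rewrite {1}es -!map_comp; apply: eq_map => x /=.
  have xA : g' (val x) \in A by apply: memim; apply: valP.
  rewrite FE g'K; congr (val (f _)); apply: val_inj; exact: g'K.
rewrite e2 -es'.
have /rel_preservingP pv := @rel_preserving_val R (im B).
have /rel_preservingP pv' := @rel_preserving_val R (im A).
have /rel_preservingP pf := hf.
have s'm : size s' <= m by rewrite -(size_map val) es' size_map.
by rewrite pv ?size_map// pv'// pf.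
Qed.

End Structures.

(** * Ages of chain models *)

(** If no finite list generates [P], one can keep picking a vector of [P] that lies above none of
    the earlier ones, which contradicts Dickson's lemma. *)
Lemma upset_generators (J : finType) (P : {ffun J -> nat} -> Prop) :
  (forall x y : {ffun J -> nat}, (forall k, x k <= y k) -> P x -> P y) ->
  exists L : seq {ffun J -> nat},
    forall x, P x <-> exists2 a, a \in L & forall k, a k <= x k.
Proof.
move=> up; apply: contrapT => noL.
have /choice[pick pickP] (L : seq {ffun J -> nat}) : exists x, {in L, forall a, P a} ->
    P x /\ forall a, a \in L -> ~ forall k, a k <= x k.
  have [LP|nLP] := pselect {in L, forall a, P a}; last by exists [ffun=> 0].
  apply: contrapT => nox; apply: noL; exists L => x; split=> [Px|[a aL ax]].
    apply: contrapT => na; apply: nox; exists x => _; split=> // a aL ax.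
    by apply: na; exists a.
  exact: up ax (LP a aL).
pose L i := iter i (fun L => pick L :: L) [::].
have LP i : {in L i, forall a, P a}.
  elim: i => // i IH a /=; rewrite inE => /predU1P[->|]; last exact: IH.
  by have [] := pickP _ IH.
have inL i j : i < j -> pick (L i) \in L j.
  elim: j => // j IH; rewrite ltnS leq_eqVlt => /predU1P[->|/IH h] /=.
    exact: mem_head.
  by rewrite inE h orbT.
have [sg [sgm le _]] := dickson (fun i k => pick (L i) k) (fun=> tt).
have [_ /(_ _ (inL _ _ (sgm 0 1 isT)))] := pickP _ (LP (sg 1)).
by apply=> k; apply: le.
Qed.

Section Models.
Variables (I : finType) (mu : I -> nat) (p : nat).
Let K : finType := {ffun I -> bool}.
Let m := \max_i mu i.
Variable kap : {ffun pattern m 'I_p.+1 -> K}.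
Implicit Types (B : 'I_p.+1 -> nat -> Prop).

Definition cell B := {x : 'I_p.+1 * nat | `[< B x.1 x.2 >]}.
Definition cell_pat B (s : seq (cell B)) : pattern m 'I_p.+1 :=
  pat m (fun x => (val x).1) (fun x => (val x).2) s.

(** A cell is a colour with a position. Finite initial segments of positions give back finite
    chains, and columns may be infinite, so that a single model covers all size vectors of a box. *)
Definition model B : structure mu :=
  @Structure I mu (cell B) (fun i t => kap (cell_pat t) i).

Lemma tuple_type_model B (s : seq (model B)) i : size s <= m ->
  tuple_type s i = (size s == mu i) && kap (cell_pat s) i.
Proof.
move=> sm; apply/idP/andP => [h|[/eqP e h]].
  have e := tuple_type_size h; split; first exact/eqP.
  by move: h; rewrite ffunE => /asboolP[t [<-]].
pose t : (mu i).-tuple (model B) := Tuple (introT eqP e).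
exact/(tuple_typeP t).
Qed.

Lemma model_sim B B' (z : seq (cell B * cell B')) : size z <= m ->
  sim (fun x => (val x).1) (fun x => (val x).2)
      (fun x => (val x).1) (fun x => (val x).2) z ->
  tuple_type (unzip1 z : seq (model B)) = tuple_type (unzip2 z : seq (model B')).
Proof.
move=> zm /(pat_sim _ _ _ _ zm) e; apply/ffunP => i.
by rewrite !tuple_type_model ?size_map// /cell_pat e.
Qed.

Lemma model_sub B B' (h : forall k j, B k j -> B' k j) :
  exists f : model B -> model B',
    [/\ injective f, rel_preserving f & forall x, val (f x) = val x].
Proof.
have hB (x : cell B) : `[< B' (val x).1 (val x).2 >].
  by apply/asboolP/h/asboolP; apply: (valP x).
pose f (x : cell B) : cell B' := exist _ (val x) (hB x).
exists f; split=> //; first by move=> x y /(congr1 val) /= /val_inj.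
apply/rel_preservingP => s sm.
have := @model_sim B' B [seq (f x, x) | x <- (s : seq (cell B))].
rewrite /unzip1 /unzip2 size_map -!map_comp map_id; apply=> //.
by move=> _ _ /mapP[x _ ->] /mapP[y _ ->].
Qed.

(** Sending an element to its colour and its rank inside that colour preserves patterns. *)
Lemma chain_model (R : structure mu) n (g : 'I_n -> R) (c : 'I_n -> 'I_p.+1) r : bijective g ->
  chain m (fun s => tuple_type (map g s)) [set: 'I_n]%SET c r ->
  (forall s, size s <= m -> kap (pat m c r s) = tuple_type (map g s)) ->
  isomorphic R (model (fun k j => j < #|[set i | c i == k]|)).
Proof.
move=> [g' gK g'K] [inj _] kapP; set B := (X in model X).
pose X k : {set 'I_n} := [set i | c i == k].
have rinj k : {in X k &, injective r}.
  move=> x y; rewrite !finset.inE => /eqP cx /eqP cy; apply: inj; rewrite ?finset.inE//.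
  by rewrite cx cy.
have XX i : i \in X (c i) by rewrite finset.inE.
have phiB i : `[< B (c i) (rank (X (c i)) r i) >] by apply/asboolP; apply: rank_lt.
pose phi i : cell B := exist _ (c i, rank (X (c i)) r i) (phiB i).
have phi_inj : injective phi.
  move=> i j /(congr1 val) /= [e]; rewrite -e; apply: rank_inj => //.
  by rewrite e.
have /choice[psi psiK] : forall x : cell B, exists i, phi i = x.
  move=> [[k j] Bkj]; have jX : j < #|X k| by move/asboolP: (Bkj).
  have [i iX ri] := rank_onto (rinj k) jX.
  exists i; apply: val_inj; move: iX; rewrite finset.inE /= => /eqP ck.
  by rewrite ck ri.
exists (phi \o g').
  exists (g \o psi) => x /=; last by rewrite gK psiK.
  by rewrite -[RHS]g'K; congr g; apply: phi_inj; rewrite psiK.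
have patE s : size s <= m -> pat m c r s = cell_pat (map phi s).
  move=> sm; pose z := [seq (i, phi i) | i <- s].
  have e1 : unzip1 z = s by rewrite /unzip1 -map_comp map_id.
  have e2 : unzip2 z = map phi s by rewrite /unzip2 -map_comp.
  rewrite -[X in pat m c r X]e1 -e2; apply/pat_sim; first by rewrite size_map.
  move=> _ _ /mapP[i _ ->] /mapP[j _ ->] /=; split=> // e.
  by rewrite -e rankE// e.
apply/rel_preservingP => s sm; rewrite map_comp; apply/ffunP => i.
have {2}<- : map g (map g' s) = s by rewrite (mapK g'K).
rewrite tuple_type_model ?size_map// -patE ?size_map// kapP ?size_map//.
by have [//|ne] := eqVneq (size s) (mu i); apply/esym/negbTE; apply: contraNN ne =>
  /tuple_type_size; rewrite !size_map => ->.
Qed.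

(** The nonempty columns are the blocks. Finite sets with the same trace sizes are matched rank by
    rank in each column, which preserves patterns and hence relations. *)
Lemma model_mondec B : has_finite_monomorphic_decomposition (model B).
Proof.
pose J := {k : 'I_p.+1 | `[< exists j, B k j >]}.
exists J, (fun k => [set x : cell B | (val x).1 = val k]%classic).
split; first split.
- apply/seteqP; split=> // x _.
  have Jx : `[< exists j, B (val x).1 j >].
    by apply/asboolP; exists (val x).2; apply/asboolP/(valP x).
  by exists (exist _ (val x).1 Jx).
- by move=> k k' _ _ [x [/= e e']]; apply: val_inj; exact: etrans (esym e) e'.
- move=> [k Jk] _; case: (asboolP _ Jk) => j Bkj.
  by exists (exist _ (k, j) (asboolT Bkj : `[< B (k, j).1 (k, j).2 >])).
move=> A A' finA finA' AA'.
have [n [g gbij]] := enum_of_finite_set finA.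
have [n' [g' g'bij]] := enum_of_finite_set finA'.
pose c i := (val (val (g i))).1; pose r i := (val (val (g i))).2.
pose c' i := (val (val (g' i))).1; pose r' i := (val (val (g' i))).2.
have card k : #|[set i | c i == k]| = #|[set i | c' i == k]|.
  have fib (D : set (cell B)) l (d : 'I_l -> {x | x \in D}) : bijective d ->
      (D `&` [set x | (val x).1 = k] #= [set` [set i | (val (val (d i))).1 == k]%SET])%card%classic.
    move=> dbij; rewrite (_ : [set i | _]%SET = [set i | `[< ([set x : cell B |
        (val x).1 = k]%classic) (val (d i)) >]]%SET); first exact: card_fiber.
    by apply/finset.setP => i; rewrite !finset.inE; apply/eqP/asboolP.
  apply/card_eq_finset; rewrite -(card_eql (fib A n g gbij)) -(card_eqr (fib A' n' g' g'bij)).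
  have [Jk|nJk] := boolP `[< exists j, B k j >]; first exact: (AA' (exist _ k Jk)).
  have e0 (D : set (cell B)) : (D `&` [set x | (val x).1 = k] = set0)%classic.
    apply/seteqP; split=> // x [_ /= xk]; case/negP: nJk; apply/asboolP.
    by exists (val x).2; rewrite -xk; apply/asboolP/(valP x).
  by rewrite !e0 card_eqxx.
have ginj (i j : 'I_n) : c i = c j -> r i = r j -> i = j.
  rewrite /c /r => e1 e2; apply: (bij_inj gbij); apply/val_inj/val_inj.
  by case: (val (val (g i))) (val (val (g j))) e1 e2 => [? ?] [? ?] /= -> ->.
have g'inj (i j : 'I_n') : c' i = c' j -> r' i = r' j -> i = j.
  rewrite /c' /r' => e1 e2; apply: (bij_inj g'bij); apply/val_inj/val_inj.
  by case: (val (val (g' i))) (val (val (g' j))) e1 e2 => [? ?] [? ?] /= -> ->.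
have [f finj fP] := matching ginj g'inj (fun k => eq_leq (card k)).
(* Summing the column sizes makes the total sizes equal, so the injective matching is a
   bijection. *)
have nn' : n = n'.
  rewrite -[LHS]card_ord -[RHS]card_ord -!sum1_card.
  rewrite (partition_big c xpredT)// [RHS](partition_big c' xpredT)//=.
  by apply: eq_bigr => k _; rewrite !sum1dep_card.
have fbij : bijective f by apply: inj_card_bij; rewrite // !card_ord nn'.
case: (gbij) => h gK hK.
exists (g' \o f \o h); first by apply: bij_comp; [apply: bij_comp|exists g].
apply/rel_preservingP => s sm.
have tv (D : set (cell B)) (u : seq (induced (R := model B) D)) : size u <= m ->
    tuple_type u = tuple_type (map val u : seq (model B)).
  move=> um; have /rel_preservingP e := @rel_preserving_val I mu (model B) D.
  by rewrite e.
rewrite !tv ?size_map// -!map_comp.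
have := @model_sim B B
  [seq (val (g' (f (h x))), val x) | x <- (s : seq {x : cell B | x \in A})].
rewrite size_map /unzip1 /unzip2 -!map_comp; apply=> //.
move=> _ _ /mapP[x _ ->] /mapP[y _ ->] /=.
have cE w : c (h w) = (val (val w)).1 by rewrite /c hK.
have rE w : r (h w) = (val (val w)).2 by rewrite /r hK.
have [cf rf] := fP (h x) (h y); have [cf' _] := fP (h y) (h x).
rewrite -!cE -!rE; split=> // e; apply: rf.
by rewrite -cf -cf'; exact: e.
Qed.

End Models.

(** * The two directions of the equivalence *)

Section Main.
Variables (I : finType) (mu : I -> nat) (C : structure mu -> Prop).
Hypothesis C_finite : forall R : structure mu, C R -> finite_structure R.
Hypothesis C_hereditary : hereditary C.
Let K : finType := {ffun I -> bool}.
Let m := \max_i mu i.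

(** A member of an age embeds into the structure [S k] and inherits the traces of its blocks; the
    largest number of blocks bounds them all. *)
Lemma decompositions_of_ages n (S : 'I_n -> structure mu) :
  (forall k, has_finite_monomorphic_decomposition (S k)) ->
  (forall R, C R -> exists k, age (S k) R) ->
  exists l, forall R, C R -> has_monomorphic_decomposition_le l R.
Proof.
move=> decS ageS.
have /choice[J JP] k : exists J : finType, exists V : J -> set (S k),
    monomorphic_decomposition V.
  exact: decS.
exists (\max_k #|J k|) => R /ageS[k [A _ [f fbij hf]]].
have [V decV] := JP k.
have [J' [V' [decV' leJ']]] : has_monomorphic_decomposition_le #|J k| R.
  apply: (mondec_restrict (h := (fun x : induced A => val x) \o f)) decV.
    by move=> x y /= /val_inj/(bij_inj fbij).
  exact: rel_preserving_comp hf (@rel_preserving_val _ _ _ _).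
exists J', V'; split=> //; apply: leq_trans leJ' _; exact: leq_bigmax.
Qed.

Section Bounded.
Variable p : nat.
Hypothesis C_chainable : forall R, C R -> exists n (g : 'I_n -> R), bijective g /\
  chainable m (fun s => tuple_type (map g s)) [set: 'I_n]%SET p.

Let Kap : finType := {ffun pattern m 'I_p.+1 -> K}.

Let box (N : {ffun 'I_p.+1 -> nat}) (k : 'I_p.+1) (j : nat) : Prop := j < N k.

(** Heredity makes the size vectors outside the class an upset; [L kap] lists finitely many
    generators of it. *)
Lemma excluded_boxes : exists L : Kap -> seq {ffun 'I_p.+1 -> nat},
  forall (kap : Kap) (N : {ffun 'I_p.+1 -> nat}),
    C (model kap (box N)) <-> forall a, a \in L kap -> exists k, N k < a k.
Proof.
have gen (kap : Kap) : exists L : seq {ffun 'I_p.+1 -> nat}, forall N,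
    ~ C (model kap (box N)) <-> exists2 a, a \in L & forall k, a k <= N k.
  apply: upset_generators => x y xy nCx Cy; apply: nCx.
  have [f [finj fr _]] := @model_sub I mu p kap (box x) (box y)
    (fun k j lt => leq_trans lt (xy k)).
  exact: hereditary_rel_preserving fr Cy.
have [L LP] := choice gen; exists L => kap N; split=> [CN a aL|h].
  apply: contrapT => na; have [_ h] := LP kap N; apply: h CN.
  by exists a => // k; rewrite leqNgt; apply/negP => lt; apply: na; exists k.
apply: contrapT => nC; have [/(_ nC)[a aL ale] _] := LP kap N.
by have [k] := h a aL; rewrite ltnNge ale.
Qed.

(* A tuple of sizes misses the generator [a] iff it is smaller than [a] at some
   coordinate; [chi] chooses one coordinate for each generator. *)
Lemma finite_union_of_ages : exists (F : finType) (S : F -> structure mu),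
  (forall k, has_finite_monomorphic_decomposition (S k)) /\
  forall R, C R <-> exists k, age (S k) R.
Proof.
have [L LP] := excluded_boxes.
(* No size is smaller than a zero coordinate, so such a coordinate is not allowed. *)
pose ok (kap : Kap) (chi : {ffun 'I_(size (L kap)) -> 'I_p.+1}) :=
  [forall a : 'I_(size (L kap)), 0 < nth [ffun=> 0] (L kap) a (chi a)].
pose T_ (kap : Kap) : finType := {chi : {ffun 'I_(size (L kap)) -> 'I_p.+1} | ok kap chi}.
(* If [j < N k < a k], then [j.+1 < a k]; this is the bound on positions. A column chosen by no
   generator is infinite. *)
pose B (kap : Kap) (chi : {ffun 'I_(size (L kap)) -> 'I_p.+1}) k j : Prop :=
  forall a, chi a = k -> j.+1 < nth [ffun=> 0] (L kap) a k.
exists {kap : Kap & T_ kap}, (fun w : {kap : Kap & T_ kap} =>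
  model (tag w) (B (tag w) (sval (tagged w : {chi | ok (tag w) chi})))).
split=> [w|R]; first exact: model_mondec.
split=> [CR|[[kap [chi chiok]] [A finA isoA]]].
  have [n [g [gbij [c [r ch]]]]] := C_chainable CR.
  have [kap kapP] := chain_pat ch.
  have iso := chain_model gbij ch kapP.
  pose N : {ffun 'I_p.+1 -> nat} := [ffun k => #|[set i | c i == k]%SET|].
  have NE k j : box N k j = (j < #|[set i | c i == k]%SET|) by rewrite /box ffunE.
  have CN : C (model kap (box N)).
    have [f fbij hf] := isomorphic_sym iso.
    have [h [hinj hr _]] : exists h : model kap (box N) -> _, _ :=
      @model_sub I mu p kap (box N) (fun k j => j < #|[set i | c i == k]%SET|)
        (fun k j lt => eq_ind _ id lt _ (NE k j)).
    apply: (hereditary_rel_preserving (h := f \o h)) CR => //.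
      by apply: inj_comp hinj; apply: bij_inj.
    exact: rel_preserving_comp hr hf.
  have chiE (a : 'I_(size (L kap))) : exists k, N k < nth [ffun=> 0] (L kap) a k.
    by have [/(_ CN) h _] := LP kap N; apply: h; apply: mem_nth.
  have [chi chiP] := choice chiE.
  have chiok : ok kap (finfun chi).
    by apply/forallP => a; rewrite ffunE; apply: leq_ltn_trans (chiP a).
  have sub k j : j < #|[set i | c i == k]%SET| -> B kap (finfun chi) k j.
    rewrite -NE => lt a; rewrite ffunE => ak.
    by apply: leq_ltn_trans (_ : N k < _); rewrite // -ak.
  exists (existT _ kap (exist _ (finfun chi) chiok)) => /=.
  have [h [hinj hr _]] := model_sub kap sub.
  have [f fbij hf] := iso.
  have hfinj : injective (h \o f) by apply: inj_comp hinj _; apply: bij_inj.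
  exists ((h \o f) @` setT)%classic.
    by apply: finite_image; apply: C_finite.
  exact: isomorphic_image hfinj (rel_preserving_comp hf hr) erefl.
have [n [g gbij]] := enum_of_finite_set finA.
(* The smallest box containing [A]. A column that misses [A] has size [0], which stays below the
   chosen coordinate by [ok]. *)
pose N : {ffun 'I_p.+1 -> nat} :=
  [ffun k => \max_(i | (val (val (g i))).1 == k) (val (val (g i))).2.+1].
have CN : C (model kap (box N)).
  apply/LP => _ /(nthP [ffun=> 0])[a aL <-]; pose a' := Ordinal aL.
  exists (chi a'); rewrite ffunE.
  have pos : 0 < nth [ffun=> 0] (L kap) a (chi a') := forallP chiok a'.
  rewrite -(prednK pos) ltnS; apply/bigmax_leqP => i /eqP e.
  have /asboolP/(_ a') := valP (val (g i)); rewrite /= e => /(_ erefl) lt.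
  by rewrite -ltnS (prednK pos).
have [f0 f0bij hf0] := isoA.
have AN (x : {x | x \in A}) : `[< box N (val (val x)).1 (val (val x)).2 >].
  apply/asboolP; rewrite /box ffunE; have [g' gK g'K] := gbij.
  by rewrite -(g'K x); apply: (leq_bigmax_cond (F := fun i => (val (val (g i))).2.+1)).
pose h (x : {x | x \in A}) : cell (box N) := exist _ (val (val x)) (AN x).
have hinj : injective h by move=> x y /(congr1 val) /= /val_inj/val_inj.
apply: (hereditary_rel_preserving (h := (h : induced A -> model kap (box N)) \o f0)) CN => //.
  by apply: inj_comp hinj _; apply: bij_inj.
apply: rel_preserving_comp hf0 _; apply/rel_preservingP => s sm.
have /rel_preservingP <- // := @rel_preserving_val _ _ _ A.
have := @model_sim I mu p kap _ _ [seq (h x, val x) | x <- (s : seq {x | x \in A})].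
rewrite size_map /unzip1 /unzip2 -!map_comp; apply=> //.
by move=> _ _ /mapP[x _ ->] /mapP[y _ ->].
Qed.

End Bounded.
End Main.

Theorem corollary1p3 (I : finType) (mu : I -> nat) (C : structure mu -> Prop)
    (C_finite : forall R : structure mu, C R -> finite_structure R)
    (C_hereditary : hereditary C) :
  (exists (m : nat) (S : 'I_m -> structure mu),
      (forall k : 'I_m, has_finite_monomorphic_decomposition (S k)) /\
      forall R : structure mu, C R <-> exists k : 'I_m, age (S k) R)
  <->
  (exists l : nat, forall R : structure mu,
      C R -> has_monomorphic_decomposition_le l R).
Proof.
split=> [[n [S [decS CS]]]|[l decC]].
  exact: (decompositions_of_ages decS (fun R => proj1 (CS R))).
(* The number of colours depends only on the signature and [l], so it is common to all members of
   [C]. *)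
have [p chP] := mondec_chainable {ffun I -> bool} (\max_i mu i) l.
have [|F [S [decS CS]]] := @finite_union_of_ages I mu C C_finite C_hereditary p.
  move=> R CR; have [n [g gbij]] := enum_of_finite_type (C_finite R CR).
  have [v mon] := mondec_of_decomposition gbij (decC R CR).
  by exists n, g; split=> //; apply: chP mon.
exists #|F|, (fun i => S (enum_val i)); split=> [k|R]; first exact: decS.
rewrite CS; split=> [[k Rk]|[k Rk]]; last by exists (enum_val k).
by exists (enum_rank k); rewrite enum_rankK.
Qed.
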